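(* Let $H$ be a Hopf algebra over a field $\mathbb{F}$ of characteristic $0$, let $A$ be an associative $H$-pseudoalgebra, and let $M$ and $N$ be two finite left $A$-modules. Then: (a) $\mathrm{Chom}(M,N)$ is a left $A$-module with the action $$(a*\phi)(u):=a*(\phi*u),\qquad a\in A,\ \phi\in\mathrm{Chom}(M,N),\ u\in M.$$ (b) $\mathrm{Chom}(M,N)$ is a right $A$-module with the action $$(\phi*a)(u):=\phi*(a*u),\qquad a\in A,\ \phi\in\mathrm{Chom}(M,N),\ u\in M.$$ (c) With these actions, $\mathrm{Chom}(M,N)$ is a bimodule over $A$.
   Context: All tensor products without subscript are over $\mathbb{F}$; $\Delta$ is the comultiplication of $H$. $H^{\otimes n}$ is a right $H$-module via $F\cdot h=F\,\Delta^{(n-1)}(h)$, where $\Delta^{(n-1)}:H\to H^{\otimes n}$ is the iterated comultiplication ($\Delta^{(0)}=\mathrm{id}$), and $H^{\otimes n}\otimes_H V$ is formed with this structure, for $V$ a left $H$-module. A map $*:V_1\otimes V_2\to H^{\otimes 2}\otimes_H V_3$ ($V_i$ left $H$-modules) is $H^{\otimes2}$-linear if $(hv_1)*(gv_2)=((h\otimes g)\otimes_H 1)(v_1*v_2)$. Such an operation extends to $(H^{\otimes n}\otimes_H V_1)\otimes(H^{\otimes m}\otimes_H V_2)\to H^{\otimes(n+m)}\otimes_H V_3$ by $$(F\otimes_H v_1)*(G\otimes_H v_2)=\sum_i (F\otimes G)\,(\Delta^{(n-1)}\otimes\Delta^{(m-1)})(g_i)\otimes_H w_i,\quad\text{if }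 v_1*v_2=\sum_i g_i\otimes_H w_i$$ (composition rule; elements of $V$ are identified with elements of $H\otimes_H V\simeq V$). An associative $H$-pseudoalgebra is a left $H$-module $A$ with an $H^{\otimes2}$-linear map $*:A\otimes A\to H^{\otimes2}\otimes_H A$ with $(a*b)*c=a*(b*c)$ in $H^{\otimes3}\otimes_H A$. A left $A$-module is a left $H$-module $M$ with an $H^{\otimes2}$-linear map $*:A\otimes M\to H^{\otimes2}\otimes_H M$ with $(a*b)*u=a*(b*u)$. A right $A$-module is a left $H$-module $M$ with an $H^{\otimes2}$-linear map $*:M\otimes A\to H^{\otimes2}\otimes_H M$ with $(u*a)*b=u*(a*b)$. A bimodule is a left and right $A$-module with $(a*u)*b=a*(u*b)$. (All for $a,b\in A$, $u\in M$, with equalities in $H^{\otimes3}\otimes_H M$.) A module is finite if it is finitely generated as an $H$-module. For left $H$-modules $M,N$, $\mathrm{Chom}(M,N)$ is the space of $H$-pseudolinear maps: $\mathbb{F}$-linear maps $\phi:M\to (H\otimes H)\otimes_H N$ with $\phi(hu)=((1\otimes h)\otimes_H 1)\phi(u)$ for $h\in H$, $u\in M$. It is a left $H$-module via $(h\phi)(u)=((h\otimes1)\otimes_H1)\phi(u)$. Write $\phi*u:=\phi(u)$; this defines an $H^{\otimes2}$-linear map $\mathrm{Chom}(M,N)\otimes M\to H^{\otimes2}\otimes_H N$, which is extended by the composition rule. In (a) and (b), $a*\phi$ and $\phi*a$ are elements of $H^{\otimes2}\otimes_H\mathrm{Chom}(M,N)$, and the defining equalities are in $H^{\otimes3}\otimes_H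 N$, where an element $X=\sum_i F_i\otimes_H\phi_i\in H^{\otimes2}\otimes_H\mathrm{Chom}(M,N)$ is evaluated at $u\in M$ by the composition rule: $X(u)=X*u=\sum_{i}(F_i\otimes_H\phi_i)*u\in H^{\otimes3}\otimes_H N$. *)

(* Defs.v *)
From HB Require Import structures.
From mathcomp Require Import all_boot all_order all_algebra.
From mathcomp Require Import boolp classical_sets functions.

Set Implicit Arguments.
Unset Strict Implicit.
Unset Printing Implicit Defensive.

Import GRing.Theory.
Local Open Scope ring_scope.
Local Open Scope quotient_scope.

(* The balanced tensor product of P and V over R, where R acts on P on the    *)
(* right through actr and on V on the left through actl: formal sums of pairs *)
(* modulo the least congruence making (p, v) |-> p (x) v biadditive and       *)
(* balanced. The opposite of p (x) v is (- p) (x) v by the tens0 rule.        *)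
Section BalancedTensor.
Variables (R : Type) (P V : zmodType).
Variables (actr : P -> R -> P) (actl : R -> V -> V).

Inductive tens_eq : seq (P * V) -> seq (P * V) -> Prop :=
| tens_refl s : tens_eq s s
| tens_sym s t : tens_eq s t -> tens_eq t s
| tens_trans s t u : tens_eq s t -> tens_eq t u -> tens_eq s u
| tens_cat s s' t t' :
    tens_eq s s' -> tens_eq t t' -> tens_eq (s ++ t) (s' ++ t')
| tens_catC s t : tens_eq (s ++ t) (t ++ s)
| tens0 v : tens_eq [:: (0, v)] [::]
| tensDl p p' v : tens_eq [:: (p + p', v)] [:: (p, v); (p', v)]
| tensDr p v v' : tens_eq [:: (p, v + v')] [:: (p, v); (p, v')]
| tens_bal p r v : tens_eq [:: (actr p r, v)] [:: (p, actl r v)].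

Definition tens_eqb : rel (seq (P * V)) := fun s t => `[< tens_eq s t >].

Lemma tens_eqb_refl : reflexive tens_eqb.
Proof. by move=> s; apply/asboolP; exact: tens_refl. Qed.

Lemma tens_eqb_sym : symmetric tens_eqb.
Proof.
by move=> s t; apply/idP/idP => /asboolP h; apply/asboolP; exact: tens_sym.
Qed.

Lemma tens_eqb_trans : transitive tens_eqb.
Proof.
move=> t s u /asboolP h1 /asboolP h2; apply/asboolP.
exact: tens_trans h1 h2.
Qed.

Definition tens_equiv := EquivRel tens_eqb tens_eqb_refl tens_eqb_sym
  tens_eqb_trans.

Definition btens : Type := {eq_quot tens_equiv}.
HB.instance Definition _ := Choice.copy btens {eq_quot tens_equiv}.

Definition btens_of (s : seq (P * V)) : btens := \pi_{eq_quot tens_equiv} s.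
Definition btens_repr (x : btens) : seq (P * V) :=
  repr (x : {eq_quot tens_equiv}).

Lemma btens_reprK x : btens_of (btens_repr x) = x.
Proof. exact: reprK. Qed.

Lemma btens_eqP s t : btens_of s = btens_of t <-> tens_eq s t.
Proof.
split=> [/eqquotP/asboolP //|h].
by apply/eqquotP/asboolP.
Qed.

Lemma btens_of_repr s : tens_eq (btens_repr (btens_of s)) s.
Proof. by apply/btens_eqP; rewrite btens_reprK. Qed.

Definition btens_add x y := btens_of (btens_repr x ++ btens_repr y).
Definition btens_opp x :=
  btens_of [seq (- pv.1, pv.2) | pv <- btens_repr x].

Lemma btens_ofD s t : btens_add (btens_of s) (btens_of t) = btens_of (s ++ t).
Proof. by apply/btens_eqP; apply: tens_cat; exact: btens_of_repr. Qed.

Lemma btens_addA : associative btens_add.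
Proof.
move=> x y z; rewrite -(btens_reprK x) -(btens_reprK y) -(btens_reprK z).
by rewrite !btens_ofD catA.
Qed.

Lemma btens_addC : commutative btens_add.
Proof. by move=> x y; apply/btens_eqP; exact: tens_catC. Qed.

Lemma btens_add0 : left_id (btens_of [::]) btens_add.
Proof. by move=> x; rewrite -(btens_reprK x) btens_ofD. Qed.

Lemma btens_addN : left_inverse (btens_of [::]) btens_opp btens_add.
Proof.
move=> x; rewrite -{2}(btens_reprK x) /btens_opp.
elim: (btens_repr x) => [|[p v] s IH] /=; first by rewrite btens_ofD.
rewrite -[_ :: map _ _]cat1s -[(p, v) :: s]cat1s -!btens_ofD.
rewrite btens_addA [X in btens_add X _]btens_addC btens_addA -btens_addA IH.
rewrite btens_addC btens_add0 btens_ofD; apply/btens_eqP.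
apply: tens_trans (tens0 v); rewrite -(subrr p).
by apply: tens_sym; exact: tensDl.
Qed.

HB.instance Definition _ :=
  GRing.isZmodule.Build btens btens_addA btens_addC btens_add0 btens_addN.

Definition btens_pure (p : P) (v : V) : btens := btens_of [:: (p, v)].

Lemma btens_pureDl v : {morph btens_pure^~ v : p p' / p + p'}.
Proof.
move=> p p'; rewrite [RHS]btens_ofD; apply/btens_eqP; exact: tensDl.
Qed.

Lemma btens_pureDr p : {morph btens_pure p : v v' / v + v'}.
Proof.
move=> v v'; rewrite [RHS]btens_ofD; apply/btens_eqP; exact: tensDr.
Qed.

Lemma btens_pure_bal p r v : btens_pure (actr p r) v = btens_pure p (actl r v).
Proof. by apply/btens_eqP; exact: tens_bal. Qed.

Lemma btens_ofE s : btens_of s = \sum_(pv <- s) btens_pure pv.1 pv.2.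
Proof.
elim: s => [|[p v] s IH]; first by rewrite big_nil.
by rewrite big_cons -IH [RHS]btens_ofD.
Qed.

Lemma btens_ind (Q : btens -> Prop) :
  Q 0 -> (forall p v, Q (btens_pure p v)) ->
  (forall x y, Q x -> Q y -> Q (x + y)) -> forall x, Q x.
Proof.
move=> Q0 Qp QD x; rewrite -(btens_reprK x) btens_ofE.
by elim/big_ind: _.
Qed.

Definition balanced (Z : zmodType) (f : P -> V -> Z) : Prop :=
  [/\ forall v, {morph f^~ v : p p' / p + p'},
      forall p, {morph f p : v v' / v + v'} &
      forall p r v, f (actr p r) v = f p (actl r v)].

(* The additive map sending p (x) v to f p v; meaningful for balanced f. *)
Definition btens_lift (Z : zmodType) (f : P -> V -> Z) (x : btens) : Z :=
  \sum_(pv <- btens_repr x) f pv.1 pv.2.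

Section Lift.
Variables (Z : zmodType) (f : P -> V -> Z).
Hypothesis fB : balanced f.

Lemma balanced_tens_eq s t : tens_eq s t ->
  \sum_(pv <- s) f pv.1 pv.2 = \sum_(pv <- t) f pv.1 pv.2.
Proof.
case: fB => fDl fDr fb; elim=> {s t} //=.
- by move=> s t u _ -> _ ->.
- by move=> s s' t t' _ e1 _ e2; rewrite !big_cat e1 e2.
- by move=> s t; rewrite !big_cat /= addrC.
- move=> v; rewrite big_seq1 big_nil /=.
  by apply: (addrI (f 0 v)); rewrite -fDl !addr0.
- by move=> p p' v; rewrite big_seq1 big_cons big_seq1 /= fDl.
- by move=> p v v'; rewrite big_seq1 big_cons big_seq1 /= fDr.
- by move=> p r v; rewrite !big_seq1 /= fb.
Qed.

Lemma btens_lift_of s : btens_lift f (btens_of s) = \sum_(pv <- s) f pv.1 pv.2.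
Proof. exact/balanced_tens_eq/btens_of_repr. Qed.

Lemma btens_lift_pure p v : btens_lift f (btens_pure p v) = f p v.
Proof. by rewrite btens_lift_of big_seq1. Qed.

Lemma btens_liftD : {morph btens_lift f : x y / x + y}.
Proof.
move=> x y; rewrite -(btens_reprK x) -(btens_reprK y).
by rewrite [X in btens_lift f X]btens_ofD !btens_lift_of big_cat.
Qed.

Lemma btens_lift0 : btens_lift f 0 = 0.
Proof. by rewrite btens_lift_of big_nil. Qed.

End Lift.

Lemma eq_btens_lift (Z : zmodType) (f g : P -> V -> Z) :
  f =2 g -> btens_lift f =1 btens_lift g.
Proof. by move=> fg x; apply: eq_bigr => pv _; exact: fg. Qed.

Lemma btens_lift_addf (Z : zmodType) (f g : P -> V -> Z) x :
  btens_lift (fun p v => f p v + g p v) x = btens_lift f x + btens_lift g x.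
Proof. exact: big_split. Qed.

End BalancedTensor.

(* Every nonzero vector over a field is detected by a linear functional. *)
Section Functional.
Variables (F : fieldType) (V : lmodType F) (v : V).
Hypothesis v_neq0 : v != 0.

Lemma exists_functional :
  exists f : V -> F, [/\ {morph f : x y / x + y},
    forall c x, f (c *: x) = c * f x & f v = 1].
Proof.
pose sub (W : set V) := forall c x y, W x -> W y -> W (c *: x + y).
pose Q (W : set V) := sub W /\ ~ W v.
have [G GQ totG|W [[Ws Wv] Wmax]] := @Zorn_bigcup V Q.
  split=> [c x y [X GX Xx] [Y GY Yy]|[X GX Xv]]; last by case: (GQ _ GX).
  case: (totG X Y GX GY) => sub_.
    by exists Y => //; apply: (GQ _ GY).1 => //; exact: sub_.
  by exists X => //; apply: (GQ _ GX).1 => //; exact: sub_.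
have W0 : W 0.
  apply: contrapT => nW0.
  pose W' : set V := fun x => W x \/ x = 0.
  apply: (Wmax W'); first split.
  - by move=> x Wx; left.
  - by move/(_ 0) => h; apply/nW0/h; right.
  split=> [c x y|[//|v0]]; last by case/eqP: v_neq0.
  case=> [Wx|->] [Wy|->]; rewrite ?scaler0 ?addr0 ?add0r.
  - by left; exact: Ws.
  - have Wxx : W (- 1 *: x + x) by exact: Ws.
    by case: nW0; rewrite scaleN1r addNr in Wxx.
  - by left.
  - by right.
have WD x y : W x -> W y -> W (x + y).
  by move=> Wx Wy; have := Ws 1 x y Wx Wy; rewrite scale1r.
have WZ c x : W x -> W (c *: x).
  by move=> Wx; have := Ws c x 0 Wx W0; rewrite addr0.
have ex x : exists c, W (x - c *: v).
  have [Wx|nWx] := pselect (W x); first by exists 0; rewrite scale0r subr0.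
  pose W' : set V := fun y => exists c, W (y - c *: x).
  have [c Wc] : W' v.
    apply: contrapT => nW'v; apply: (Wmax W'); first split.
    - by move=> y Wy; exists 0; rewrite scale0r subr0.
    - by move/(_ x) => h; apply/nWx/h; exists 1; rewrite scale1r subrr.
    - split=> // c y z [a Wa] [b Wb]; exists (c * a + b).
      rewrite scalerDl opprD addrACA -scalerA -scalerBr.
      exact: Ws.
  have c0 : c != 0.
    by apply: contra_notN Wv => /eqP c0; rewrite c0 scale0r subr0 in Wc.
  exists c^-1; have := WZ (- c^-1) _ Wc.
  by rewrite scaleNr scalerBr scalerA mulVf // scale1r opprB.
have uq x a b : W (x - a *: v) -> W (x - b *: v) -> a = b.
  move=> Wa Wb; apply/eqP; rewrite -subr_eq0; apply/negPn/negP => ab.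
  apply: Wv; have := WZ (a - b)^-1 _ (WD _ _ (WZ (-1) _ Wa) Wb).
  rewrite scaleN1r opprB addrA subrK -scalerBl scalerA mulVf //.
  by rewrite scale1r.
have [f fP] := choice ex.
exists f; split=> [x y|c x|].
- apply: (uq (x + y)) => //; rewrite scalerDl opprD addrACA.
  exact: WD.
- apply: (uq (c *: x)) => //.
  by rewrite -scalerA -scalerBr; exact: WZ.
- by apply: (uq v) => //; rewrite scale1r subrr.
Qed.

End Functional.

Section TensorProduct.
Variables (F : fieldType) (A B : lmodType F).

Definition tprod : Type :=
  btens (fun (a : A) (c : F) => c *: a) (fun (c : F) (b : B) => c *: b).
HB.instance Definition _ := GRing.Zmodule.on tprod.

Definition tpure (a : A) (b : B) : tprod := btens_pure _ _ a b.

Lemma tpureDl b : {morph tpure^~ b : a a' / a + a'}.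
Proof. exact: btens_pureDl. Qed.

Lemma tpureDr a : {morph tpure a : b b' / b + b'}.
Proof. exact: btens_pureDr. Qed.

Lemma tpureZ c a b : tpure (c *: a) b = tpure a (c *: b).
Proof. exact: btens_pure_bal. Qed.

Lemma tprod_ind (Q : tprod -> Prop) :
  Q 0 -> (forall a b, Q (tpure a b)) ->
  (forall x y, Q x -> Q y -> Q (x + y)) -> forall x, Q x.
Proof. exact: btens_ind. Qed.

Definition bilinear_map (Z : lmodType F) (f : A -> B -> Z) : Prop :=
  (forall b, linear (f^~ b)) /\ (forall a, linear (f a)).

(* The linear map sending a (x) b to f a b; meaningful for bilinear f. *)
Definition tlift (Z : zmodType) (f : A -> B -> Z) (x : tprod) : Z :=
  btens_lift f x.

Definition tscale (c : F) : tprod -> tprod :=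
  tlift (fun a b => tpure (c *: a) b).

Lemma tscale_balanced c :
  balanced (fun (a : A) (c : F) => c *: a) (fun (c : F) (b : B) => c *: b)
    (fun a b => tpure (c *: a) b).
Proof.
split=> [b a a'|a b b'|a d b].
- by rewrite scalerDr tpureDl.
- by rewrite tpureDr.
- by rewrite -tpureZ !scalerA mulrC.
Qed.

Lemma tscaleE c a b : tscale c (tpure a b) = tpure (c *: a) b.
Proof. exact/btens_lift_pure/tscale_balanced. Qed.

Lemma tscaleDr : right_distributive tscale +%R.
Proof. move=> c; exact/btens_liftD/tscale_balanced. Qed.

Lemma tscale0 c : tscale c 0 = 0.
Proof. by apply: (addrI (tscale c 0)); rewrite -tscaleDr !addr0. Qed.

Lemma tscaleA c d x : tscale c (tscale d x) = tscale (c * d) x.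
Proof.
elim/tprod_ind: x => [|a b|x y hx hy]; first by rewrite !tscale0.
  by rewrite !tscaleE scalerA.
by rewrite !tscaleDr hx hy.
Qed.

Lemma tscale1 : left_id 1 tscale.
Proof.
elim/tprod_ind=> [|a b|x y hx hy]; first by rewrite tscale0.
  by rewrite tscaleE scale1r.
by rewrite tscaleDr hx hy.
Qed.

Lemma tscaleDl x : {morph tscale^~ x : c d / c + d}.
Proof.
move=> c d; elim/tprod_ind: x => [|a b|x y hx hy].
- by rewrite !tscale0 addr0.
- by rewrite !tscaleE scalerDl tpureDl.
- by rewrite !tscaleDr hx hy addrACA.
Qed.

HB.instance Definition _ := GRing.Zmodule_isLmodule.Build F tprod
  tscaleA tscale1 tscaleDr tscaleDl.

Lemma tpureZl c a b : tpure (c *: a) b = c *: tpure a b.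
Proof. by rewrite [RHS]tscaleE. Qed.

Lemma tpureZr c a b : tpure a (c *: b) = c *: tpure a b.
Proof. by rewrite -tpureZ tpureZl. Qed.

Lemma bilinear_balanced (Z : lmodType F) (f : A -> B -> Z) : bilinear_map f ->
  balanced (fun (a : A) (c : F) => c *: a) (fun (c : F) (b : B) => c *: b) f.
Proof.
move=> [fl fr]; have fZl c a b : f (c *: a) b = c *: f a b.
  have f0 : f 0 b = 0.
    apply: (addrI (f 0 b)); rewrite addr0 -[X in X + _]scale1r.
    by rewrite -(fl b 1) scaler0 addr0.
  by have := fl b c a 0; rewrite addr0 f0 addr0.
have fZr c a b : f a (c *: b) = c *: f a b.
  have f0 : f a 0 = 0.
    apply: (addrI (f a 0)); rewrite addr0 -[X in X + _]scale1r.
    by rewrite -(fr a 1) scaler0 addr0.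
  by have := fr a c b 0; rewrite addr0 f0 addr0.
split=> [b a a'|a b b'|a c b]; last by rewrite fZl fZr.
- by have := fl b 1 a a'; rewrite !scale1r.
- by have := fr a 1 b b'; rewrite !scale1r.
Qed.

Section TLift.
Variables (Z : lmodType F) (f : A -> B -> Z).
Hypothesis fB : bilinear_map f.

Lemma tlift_pure a b : tlift f (tpure a b) = f a b.
Proof. exact/btens_lift_pure/bilinear_balanced. Qed.

Lemma tliftD : {morph tlift f : x y / x + y}.
Proof. exact/btens_liftD/bilinear_balanced. Qed.

Lemma tlift0 : tlift f 0 = 0.
Proof. exact/btens_lift0/bilinear_balanced. Qed.

Lemma tliftZ c x : tlift f (c *: x) = c *: tlift f x.
Proof.
elim/tprod_ind: x => [|a b|x y hx hy]; first by rewrite !scaler0 tlift0 scaler0.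
  rewrite -tpureZl !tlift_pure; have [fDl _ _] := bilinear_balanced fB.
  have := fB.1 b c a 0; rewrite addr0 => ->.
  suff -> : f 0 b = 0 by rewrite addr0.
  by apply: (addrI (f 0 b)); rewrite -fDl !addr0.
by rewrite scalerDr !tliftD hx hy scalerDr.
Qed.

Lemma tlift_linear : linear (tlift f).
Proof. by move=> c x y; rewrite tliftD tliftZ. Qed.

End TLift.

Lemma tlift_linear_fun (Z : lmodType F) (T : lmodType F)
    (f : T -> A -> B -> Z) x :
  (forall a b, linear (fun t => f t a b)) -> linear (fun t => tlift (f t) x).
Proof.
move=> fl c t u; rewrite /tlift /btens_lift scaler_sumr -big_split /=.
by apply: eq_bigr => pv _; rewrite fl.
Qed.

Lemma tpure_bilinear : bilinear_map tpure.
Proof.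
split=> [b c a a'|a c b b']; first by rewrite tpureDl tpureZl.
by rewrite tpureDr tpureZr.
Qed.

End TensorProduct.

Notation "a \ox b" := (tpure a b) (at level 40, left associativity) :
  ring_scope.

Section TensorAlgebra.
Variables (F : fieldType) (A B : algType F).
Local Notation AB := (tprod A B).

Definition tmul (x y : AB) : AB :=
  tlift (fun a b => tlift (fun a' b' => (a * a') \ox (b * b')) y) x.

Lemma tmul_bilin1 (a : A) (b : B) :
  bilinear_map (fun a' b' => (a * a') \ox (b * b')).
Proof.
split=> [b' c a1 a2|a' c b1 b2].
  by rewrite mulrDr tpureDl -scalerAr tpureZl.
by rewrite mulrDr tpureDr -scalerAr tpureZr.
Qed.

Lemma tmul_bilin2 y : bilinear_map (fun (a : A) (b : B) =>
  tlift (fun a' b' => (a * a') \ox (b * b')) y).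
Proof.
split=> [b|a]; apply: tlift_linear_fun => a' b' c x z.
  by rewrite mulrDl tpureDl -scalerAl tpureZl.
by rewrite mulrDl tpureDr -scalerAl tpureZr.
Qed.

Lemma tmulE a b a' b' : tmul (a \ox b) (a' \ox b') = (a * a') \ox (b * b').
Proof.
by rewrite /tmul tlift_pure; [rewrite tlift_pure //; exact: tmul_bilin1
                             |exact: tmul_bilin2].
Qed.

Lemma tmulDl : left_distributive tmul +%R.
Proof. by move=> x y z; rewrite /tmul tliftD //; exact: tmul_bilin2. Qed.

Lemma tmulDr : right_distributive tmul +%R.
Proof.
move=> x y z; rewrite /tmul /tlift -btens_lift_addf; apply: eq_btens_lift.
by move=> a b; rewrite -[LHS]/(tlift _ _) tliftD //; exact: tmul_bilin1.
Qed.

Lemma tmul0l x : tmul 0 x = 0.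
Proof. by apply: (addrI (tmul 0 x)); rewrite -tmulDl !addr0. Qed.

Lemma tmul0r x : tmul x 0 = 0.
Proof. by apply: (addrI (tmul x 0)); rewrite -tmulDr !addr0. Qed.

Lemma tmulA : associative tmul.
Proof.
move=> x y z; elim/tprod_ind: x => [|a b|x x' hx hx'].
- by rewrite !tmul0l.
- elim/tprod_ind: y => [|a' b'|y y' hy hy'].
  + by rewrite !(tmul0l, tmul0r).
  + elim/tprod_ind: z => [|a2 b2|z z' hz hz']; first by rewrite !tmul0r.
      by rewrite !tmulE !mulrA.
    by rewrite !tmulDr hz hz'.
  + by rewrite tmulDl !tmulDr tmulDl hy hy'.
- by rewrite !tmulDl hx hx'.
Qed.

Lemma tmul1l : left_id (1 \ox 1) tmul.
Proof.
elim/tprod_ind=> [|a b|x x' hx hx']; first by rewrite tmul0r.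
  by rewrite tmulE !mul1r.
by rewrite tmulDr hx hx'.
Qed.

Lemma tmul1r : right_id (1 \ox 1) tmul.
Proof.
elim/tprod_ind=> [|a b|x x' hx hx']; first by rewrite tmul0l.
  by rewrite tmulE !mulr1.
by rewrite tmulDl hx hx'.
Qed.

Lemma tmul1_neq0 : (1 : A) \ox (1 : B) != 0.
Proof.
have [f [fD fZ f1]] := exists_functional (oner_neq0 A).
have [g [gD gZ g1]] := exists_functional (oner_neq0 B).
pose fg (a : A) (b : B) : F^o := f a * g b.
have fgB : bilinear_map fg.
  split=> [b c a a'|a c b b']; rewrite /fg.
    by rewrite fD fZ mulrDl -mulrA.
  by rewrite gD gZ mulrDr mulrCA.
apply/eqP => /(congr1 (tlift fg)); rewrite tlift0 // tlift_pure //.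
by rewrite /fg f1 g1 mulr1 => /eqP; rewrite oner_eq0.
Qed.

HB.instance Definition _ := GRing.Zmodule_isNzRing.Build AB
  tmulA tmul1l tmul1r tmulDl tmulDr tmul1_neq0.

Lemma tpureM (a a' : A) (b b' : B) :
  (a \ox b) * (a' \ox b') = (a * a') \ox (b * b').
Proof. exact: tmulE. Qed.

Lemma tprod_scalerAl (c : F) (x y : AB) : c *: (x * y) = (c *: x) * y.
Proof. by rewrite [RHS]tliftZ //; exact: tmul_bilin2. Qed.

HB.instance Definition _ :=
  GRing.Lmodule_isLalgebra.Build F AB tprod_scalerAl.

Lemma tprod_scalerAr (c : F) (x y : AB) : c *: (x * y) = x * (c *: y).
Proof.
elim/tprod_ind: x => [|a b|x x' hx hx'].
- by rewrite !mul0r scaler0.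
- elim/tprod_ind: y => [|a' b'|y y' hy hy'].
  + by rewrite !(scaler0, mulr0).
  + by rewrite -tpureZl !tpureM -tpureZl scalerAr.
  + by rewrite mulrDr !scalerDr mulrDr hy hy'.
- by rewrite !mulrDl scalerDr hx hx'.
Qed.

HB.instance Definition _ :=
  GRing.Lalgebra_isAlgebra.Build F AB tprod_scalerAr.

End TensorAlgebra.

Section TensorPower.
Variables (F : fieldType) (H : algType F).

(* tpow n is the tensor power of H with n.+1 factors. *)
Fixpoint tpow (n : nat) : algType F :=
  if n is m.+1 then tprod H (tpow m) else H.

(* F (x) G, reassociated; the total number of factors is n.+1 + m.+1. *)
Fixpoint tcat (n m : nat) : tpow n -> tpow m -> tpow (n + m).+1 :=
  match n return tpow n -> tpow m -> tpow (n + m).+1 with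
  | 0%N => fun x y => (x : H) \ox y
  | n'.+1 => fun x y => tlift (fun h x' => h \ox tcat x' y) x
  end.

Lemma tcat_bilinear n m : bilinear_map (@tcat n m).
Proof.
elim: n => [|n [IHl IHr]]; first exact: tpure_bilinear.
have fB y : bilinear_map (fun (h : H) x' => h \ox @tcat n m x' y).
  split=> [x' c h h'|h c x' x2]; first by rewrite tpureDl tpureZl.
  by rewrite IHl tpureDr tpureZr.
have step x y :
  @tcat n.+1 m x y = tlift (fun h x' => h \ox @tcat n m x' y) x by [].
split=> [y|x] c z z'; rewrite !step; first exact: (tlift_linear (fB y)).
apply: (@tlift_linear_fun F H (tpow n) (tprod H (tpow (n + m).+1)) (tpow m)
  (fun y h x' => h \ox @tcat n m x' y)) => h x' d y y'.
by rewrite (IHr x' d y y') tpureDr tpureZr.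
Qed.

Lemma tcatS_bilinear n m (y : tpow m) :
  bilinear_map (fun (h : H) (x : tpow n) => h \ox tcat x y).
Proof.
have [cl cr] := tcat_bilinear n m.
split=> [x' c h h'|h c x' x2]; first by rewrite tpureDl tpureZl.
by rewrite cl tpureDr tpureZr.
Qed.

Lemma tcatS n m (h : H) (x : tpow n) (y : tpow m) :
  @tcat n.+1 m (h \ox x) y = h \ox tcat x y.
Proof. by rewrite /= tlift_pure //; exact: tcatS_bilinear. Qed.

End TensorPower.

HB.mixin Record Algebra_isHopf (F : fieldType) H of GRing.Algebra F H := {
  comul : {lrmorphism H -> tprod H H};
  counit : {lrmorphism H -> F^o};
  antipode : {linear H -> H};
  coassoc : forall h : H,
    tlift (fun g g' => @tcat F H 1 0 (comul g) g') (comul h) =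
    tlift (fun g g' => @tcat F H 0 1 g (comul g')) (comul h);
  counitl : forall h : H,
    tlift (fun g g' => (counit g : F) *: g') (comul h) = h;
  counitr : forall h : H,
    tlift (fun g g' => (counit g' : F) *: g) (comul h) = h;
  antipodel : forall h : H,
    tlift (fun g g' => antipode g * g') (comul h) = (counit h : F)%:A;
  antipoder : forall h : H,
    tlift (fun g g' => g * antipode g') (comul h) = (counit h : F)%:A
}.

#[short(type="hopfType")]
HB.structure Definition Hopf (F : fieldType) :=
  {H of GRing.Algebra F H & Algebra_isHopf F H}.

Section IteratedCoproduct.
Variables (F : fieldType) (H : hopfType F).

(* The iterated comultiplication with values in n.+1 tensor factors. *)
Fixpoint icomul (n : nat) : H -> tpow H n :=
  match n return H -> tpow H n with
  | 0%N => fun h => h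
  | m.+1 => fun h => tlift (fun h1 h2 => h1 \ox icomul m h2) (comul h)
  end.

(* icomul n (x) icomul m : H (x) H -> H^(n.+1 + m.+1) *)
Definition icomul2 (n m : nat) (g : tpow H 1) : tpow H (n + m).+1 :=
  tlift (fun h h' : H => tcat (icomul n h) (icomul m h')) g.

End IteratedCoproduct.

Section PseudoTensor.
Variables (F : fieldType) (H : hopfType F) (n : nat) (V : lmodType H).

(* H^(n.+1) (x)_H V *)
Definition pten : Type :=
  btens (fun (x : tpow H n) (h : H) => x * icomul n h)
        (fun (h : H) (v : V) => h *: v).
HB.instance Definition _ := GRing.Zmodule.on pten.

Definition ppure (x : tpow H n) (v : V) : pten := btens_pure _ _ x v.

Lemma ppureDl v : {morph ppure^~ v : x y / x + y}.
Proof. exact: btens_pureDl. Qed.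

Lemma ppureDr x : {morph ppure x : v w / v + w}.
Proof. exact: btens_pureDr. Qed.

Lemma ppure_bal x h v : ppure (x * icomul n h) v = ppure x (h *: v).
Proof. exact: btens_pure_bal. Qed.

Lemma pten_ind (Q : pten -> Prop) :
  Q 0 -> (forall x v, Q (ppure x v)) ->
  (forall x y, Q x -> Q y -> Q (x + y)) -> forall x, Q x.
Proof. exact: btens_ind. Qed.

Definition plift (Z : zmodType) (f : tpow H n -> V -> Z) (X : pten) : Z :=
  btens_lift f X.

Definition pbalanced (Z : zmodType) (f : tpow H n -> V -> Z) : Prop :=
  balanced (fun (x : tpow H n) (h : H) => x * icomul n h)
           (fun (h : H) (v : V) => h *: v) f.

Section PLift.
Variables (Z : zmodType) (f : tpow H n -> V -> Z).
Hypothesis fB : pbalanced f.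

Lemma plift_pure x v : plift f (ppure x v) = f x v.
Proof. exact: btens_lift_pure. Qed.

Lemma pliftD : {morph plift f : x y / x + y}.
Proof. exact: btens_liftD. Qed.

Lemma plift0 : plift f 0 = 0.
Proof. exact: btens_lift0. Qed.
End PLift.

(* H^(n.+1) acts on H^(n.+1) (x)_H V by left multiplication. *)
Definition pscale (y : tpow H n) : pten -> pten :=
  plift (fun x v => ppure (y * x) v).

Lemma pscale_balanced y : pbalanced (fun x v => ppure (y * x) v).
Proof.
split=> [v x x'|x v v'|x h v]; first by rewrite mulrDr ppureDl.
  by rewrite ppureDr.
by rewrite mulrA ppure_bal.
Qed.

Lemma pscaleE y x v : pscale y (ppure x v) = ppure (y * x) v.
Proof. exact/plift_pure/pscale_balanced. Qed.

Lemma pscaleDr : right_distributive pscale +%R.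
Proof. by move=> y; apply: pliftD; exact: pscale_balanced. Qed.

Lemma pscale0 y : pscale y 0 = 0.
Proof. by apply: plift0; exact: pscale_balanced. Qed.

Lemma pscaleA y z X : pscale y (pscale z X) = pscale (y * z) X.
Proof.
elim/pten_ind: X => [|x v|X Y hX hY]; first by rewrite !pscale0.
  by rewrite !pscaleE mulrA.
by rewrite !pscaleDr hX hY.
Qed.

Lemma pscale1 : left_id 1 pscale.
Proof.
elim/pten_ind=> [|x v|X Y hX hY]; first by rewrite pscale0.
  by rewrite pscaleE mul1r.
by rewrite pscaleDr hX hY.
Qed.

Lemma pscaleDl X : {morph pscale^~ X : y z / y + z}.
Proof.
move=> y z; elim/pten_ind: X => [|x v|X Y hX hY].
- by rewrite !pscale0 addr0.
- by rewrite !pscaleE mulrDl ppureDl.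
- by rewrite !pscaleDr hX hY addrACA.
Qed.

HB.instance Definition _ := GRing.Zmodule_isLmodule.Build (tpow H n) pten
  pscaleA pscale1 pscaleDr pscaleDl.

Lemma ppureZ y x v : ppure (y * x) v = y *: ppure x v.
Proof. by rewrite [RHS]pscaleE. Qed.

End PseudoTensor.

Notation "x \oxH v" := (ppure x v) (at level 40, left associativity) :
  ring_scope.

(* The identification of V with H (x)_H V. *)
Definition pone (F : fieldType) (H : hopfType F) (V : lmodType H) (v : V) :
  pten 0 V := (1 : tpow H 0) \oxH v.

Section PseudoProduct.
Variables (F : fieldType) (H : hopfType F).

(* F-bilinearity and H^2-linearity; homogeneity over F is contained in        *)
(* pbilinZ, a scalar c acting on every H-module as c%:A.                      *)
Record pbilinear (V1 V2 V3 : lmodType H) (op : V1 -> V2 -> pten 1 V3) : Prop :=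
  PBilinear {
    pbilinDl : forall v2, {morph op^~ v2 : u v / u + v};
    pbilinDr : forall v1, {morph op v1 : u v / u + v};
    pbilinZ : forall (h g : H) v1 v2,
      op (h *: v1) (g *: v2) = ((h \ox g) : tpow H 1) *: op v1 v2
  }.

(* The composition rule:                                                      *)
(* (x (x)_H v1) * (y (x)_H v2) is obtained from v1 * v2 by applying           *)
(* g (x)_H w |-> (x (x) y) (icomul n (x) icomul m)(g) (x)_H w.                *)
Definition pseudoprod (V1 V2 V3 : lmodType H) (op : V1 -> V2 -> pten 1 V3)
    (n m : nat) (X : pten n V1) (Y : pten m V2) : pten (n + m).+1 V3 :=
  plift (fun x v1 => plift (fun y v2 =>
    plift (fun g w => (tcat x y * icomul2 n m g) \oxH w) (op v1 v2)) Y) X.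

End PseudoProduct.

Section Multiplicativity.
Variables (F : fieldType) (H : hopfType F).

Lemma tcatDl n m (y : tpow H m) : {morph (@tcat F H n m)^~ y : a b / a + b}.
Proof.
by move=> a b; have := (tcat_bilinear H n m).1 y 1 a b; rewrite !scale1r.
Qed.

Lemma tcatDr n m (x : tpow H n) : {morph @tcat F H n m x : a b / a + b}.
Proof.
by move=> a b; have := (tcat_bilinear H n m).2 x 1 a b; rewrite !scale1r.
Qed.

Lemma tcat0l n m (y : tpow H m) : @tcat F H n m 0 y = 0.
Proof. by apply: (addrI (tcat 0 y)); rewrite -tcatDl !addr0. Qed.

Lemma tcat0r n m (x : tpow H n) : @tcat F H n m x 0 = 0.
Proof. by apply: (addrI (tcat x 0)); rewrite -tcatDr !addr0. Qed.

Lemma tcat_mulr n m (x x' : tpow H n) (y y' : tpow H m) :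
  tcat (x * x') (y * y') = tcat x y * tcat x' y'.
Proof.
elim: n x x' => [|n IH] x x'; first by rewrite /= [RHS]tpureM.
elim/(@tprod_ind F H (tpow H n)): x => [|h x|x z hx hz].
- by rewrite mul0r !tcat0l mul0r.
- elim/(@tprod_ind F H (tpow H n)): x' => [|h' x'|x' z hx' hz].
  + by rewrite mulr0 !tcat0l mulr0.
  + have -> : (h \ox x : tpow H n.+1) * (h' \ox x') = (h * h') \ox (x * x').
      exact: tpureM.
    rewrite !tcatS IH; exact/esym/tpureM.
  + by rewrite mulrDr !tcatDl mulrDr hx' hz.
- by rewrite mulrDl !tcatDl mulrDl hx hz.
Qed.

Lemma tcat11 n m : tcat (1 : tpow H n) (1 : tpow H m) = 1.
Proof.
elim: n => [//|n IH].
have -> : (1 : tpow H n.+1) = (1 : H) \ox (1 : tpow H n) by [].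
by rewrite tcatS IH.
Qed.

Lemma tlift_lin (A B : lmodType F) (Z : lmodType F) (f : A -> B -> Z) :
  bilinear_map f -> forall c x y, tlift f (c *: x + y) =
    c *: tlift f x + tlift f y.
Proof. by move=> fB c x y; rewrite tlift_linear. Qed.

Lemma icomul_linear n : linear (@icomul F H n : H -> tpow H n).
Proof.
elim: n => [//|n IH] c h h'.
have fB : bilinear_map (fun h1 h2 : H => h1 \ox icomul n h2).
  split=> [h2 d a b|h1 d a b]; first by rewrite tpureDl tpureZl.
  by rewrite IH tpureDr tpureZr.
have step a : icomul n.+1 a =
  tlift (fun h1 h2 : H => h1 \ox icomul n h2) (comul a) by [].
by rewrite !step linearP; exact: (tlift_lin fB).
Qed.

Lemma icomulS_bilinear n :
  bilinear_map (fun h1 h2 : H => h1 \ox icomul n h2).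
Proof.
split=> [h2 d a b|h1 d a b]; first by rewrite tpureDl tpureZl.
by rewrite icomul_linear tpureDr tpureZr.
Qed.

Lemma icomulD n (h h' : H) : icomul n (h + h') = icomul n h + icomul n h'.
Proof. by have := icomul_linear n 1 h h'; rewrite !scale1r. Qed.

Lemma icomul2_bilinear n m :
  bilinear_map (fun h h' : H => tcat (icomul n h) (icomul m h')).
Proof.
split=> [h' c a b|h c a b]; rewrite icomul_linear.
  exact: (tcat_bilinear H n m).1.
exact: (tcat_bilinear H n m).2.
Qed.

Lemma icomul2_pure n m (h h' : H) :
  icomul2 n m (h \ox h') = tcat (icomul n h) (icomul m h').
Proof. exact/tlift_pure/icomul2_bilinear. Qed.

Lemma icomul2D n m (g g' : tpow H 1) :
  icomul2 n m (g + g') = icomul2 n m g + icomul2 n m g'.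
Proof. exact/tliftD/icomul2_bilinear. Qed.

Lemma icomul2_0 n m : icomul2 n m (0 : tpow H 1) = 0.
Proof. by apply: tlift0; exact: icomul2_bilinear. Qed.

Lemma icomul1 (h : H) : icomul 1 h = comul h.
Proof.
rewrite /=; elim/tprod_ind: (comul h) => [|a b|x y hx hy].
- by rewrite tlift0 //; exact: tpure_bilinear.
- by rewrite tlift_pure //; exact: tpure_bilinear.
- by rewrite tliftD ?hx ?hy //; exact: tpure_bilinear.
Qed.

Lemma icomulM n (h h' : H) : icomul n (h * h') = icomul n h * icomul n h'.
Proof.
elim: n h h' => [//|n IH] h h'.
have step a : icomul n.+1 a =
  tlift (fun h1 h2 : H => h1 \ox icomul n h2) (comul a) by [].
have B := icomulS_bilinear n.
rewrite !step rmorphM /=.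
elim/tprod_ind: (comul h) => [|a b|x y hx hy].
- by rewrite mul0r tlift0 // mul0r.
- elim/tprod_ind: (comul h') => [|a' b'|x y hx hy].
  + by rewrite mulr0 tlift0 // mulr0.
  + by rewrite tpureM !tlift_pure // IH; exact/esym/tpureM.
  + by rewrite mulrDr !tliftD // mulrDr hx hy.
- by rewrite mulrDl !tliftD // mulrDl hx hy.
Qed.

Lemma icomul_1 n : icomul n (1 : H) = 1.
Proof.
elim: n => [//|n IH].
have -> : icomul n.+1 1 =
  tlift (fun h1 h2 : H => h1 \ox icomul n h2) (comul (1 : H)) by [].
rewrite rmorph1 -[X in tlift _ X]/((1 : H) \ox (1 : H)).
by rewrite (tlift_pure (icomulS_bilinear n)) IH.
Qed.

Lemma icomul2M n m (g g' : tpow H 1) :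
  icomul2 n m (g * g') = icomul2 n m g * icomul2 n m g'.
Proof.
elim/(@tprod_ind F H H): g => [|a b|x y hx hy].
- by rewrite mul0r !icomul2_0 mul0r.
- elim/(@tprod_ind F H H): g' => [|a' b'|x y hx hy].
  + by rewrite mulr0 !icomul2_0 mulr0.
  + have -> : (a \ox b : tpow H 1) * (a' \ox b') = (a * a') \ox (b * b').
      exact: tpureM.
    by rewrite !icomul2_pure !icomulM tcat_mulr.
  + by rewrite mulrDr !icomul2D mulrDr hx hy.
- by rewrite mulrDl !icomul2D mulrDl hx hy.
Qed.

Lemma icomul2_comul n m (h : H) :
  icomul2 n m (comul h) = icomul (n + m).+1 h.
Proof.
elim: n h => [//|n IH] h.
pose G (x : tpow H 2) : tpow H (n.+1 + m).+1 :=
  tlift (fun h1 h23 => h1 \ox icomul2 n m h23) x.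
have GB : bilinear_map (fun (h1 : H) (h23 : tprod H H) =>
    h1 \ox icomul2 n m h23).
  split=> [h2 d a b|h1 d a b]; first by rewrite tpureDl tpureZl.
  have -> : icomul2 n m (d *: a + b) = d *: icomul2 n m a + icomul2 n m b.
    exact: (tlift_lin (icomul2_bilinear n m)).
  by rewrite tpureDr tpureZr.
have GD x y : G (x + y) = G x + G y by exact: (tliftD GB).
have G0 : G 0 = 0 by exact: (tlift0 GB).
have cl : linear (comul : H -> tprod H H) by move=> c a b; exact: linearP.
have LB : bilinear_map (fun g g' : H => @tcat F H 1 0 (comul g) g').
  split=> [b c x y|a c x y].
    by rewrite cl; exact: (tcat_bilinear H 1 0).1.
  exact: (tcat_bilinear H 1 0).2.
have RB : bilinear_map (fun g g' : H => @tcat F H 0 1 g (comul g')).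
  split=> [b c x y|a c x y].
    exact: (tcat_bilinear H 0 1).1.
  by rewrite cl; exact: (tcat_bilinear H 0 1).2.
have := congr1 G (coassoc h).
suff [-> ->] : (forall x, G (tlift (fun g g' => @tcat F H 1 0 (comul g) g') x)
                   = icomul2 n.+1 m x) /\
           (forall x, G (tlift (fun g g' => @tcat F H 0 1 g (comul g')) x)
                   = tlift (fun h1 h2 : H => h1 \ox icomul (n + m).+1 h2) x).
  by [].
split=> x; elim/tprod_ind: x => [|a b|x y hx hy].
- by rewrite tlift0 // G0 icomul2_0.
- rewrite tlift_pure // icomul2_pure.
  have -> : icomul n.+1 a =
    tlift (fun h1 h2 : H => h1 \ox icomul n h2) (comul a) by [].
  have SB := icomulS_bilinear n.
  elim/tprod_ind: (comul a) => [|a1 a2|x y hx hy].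
  + by rewrite (tlift0 SB) !tcat0l G0.
  + rewrite (tlift_pure SB) !tcatS /G (tlift_pure GB).
    by congr (_ \ox _); exact: icomul2_pure.
  + by rewrite (tliftD SB) !tcatDl GD hx hy.
- by rewrite !tliftD // GD hx hy icomul2D.
- by rewrite !tlift0 ?G0 //; exact: icomulS_bilinear.
- rewrite !tlift_pure //; last exact: icomulS_bilinear.
  have -> : @tcat F H 0 1 a (comul b) = a \ox comul b by [].
  by rewrite /G (tlift_pure GB) IH.
- by rewrite !tliftD ?GD ?hx ?hy //; exact: icomulS_bilinear.
Qed.

End Multiplicativity.

Section CompositionRule.
Variables (F : fieldType) (H : hopfType F) (V1 V2 V3 : lmodType H).
Variable op : V1 -> V2 -> pten 1 V3.
Hypothesis opB : pbilinear op.
Variables n m : nat.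

Local Notation expand x y := (plift (fun (g : tpow H 1) (w : V3) =>
  (tcat x y * icomul2 n m g) \oxH w)).

Lemma pseudoprod_balanced0 (x : tpow H n) (y : tpow H m) :
  pbalanced (fun (g : tpow H 1) (w : V3) => (tcat x y * icomul2 n m g) \oxH w).
Proof.
split=> [w g g'|g w w'|g h w]; first by rewrite icomul2D mulrDr ppureDl.
  by rewrite ppureDr.
by rewrite icomul1 icomul2M icomul2_comul mulrA ppure_bal.
Qed.

Lemma pseudoprod_expandZ x y a b (Z : pten 1 V3) :
  expand x y (((a \ox b) : tpow H 1) *: Z) =
  expand (x * icomul n a) (y * icomul m b) Z.
Proof.
have B := pseudoprod_balanced0.
elim/pten_ind: Z => [|g w|Z Z' hZ hZ'].
- by rewrite scaler0 !(plift0 (B _ _)).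
- rewrite -ppureZ !(plift_pure (B _ _)) icomul2M icomul2_pure.
  by rewrite mulrA tcat_mulr.
- by rewrite scalerDr !(pliftD (B _ _)) hZ hZ'.
Qed.

Lemma pseudoprod_expandDl x x' y Z :
  expand (x + x') y Z = expand x y Z + expand x' y Z.
Proof.
rewrite /plift -btens_lift_addf; apply: eq_btens_lift => g w.
by rewrite tcatDl mulrDl ppureDl.
Qed.

Lemma pseudoprod_expandDr x y y' Z :
  expand x (y + y') Z = expand x y Z + expand x y' Z.
Proof.
rewrite /plift -btens_lift_addf; apply: eq_btens_lift => g w.
by rewrite tcatDr mulrDl ppureDl.
Qed.

Lemma pseudoprod_balanced1 x v1 :
  pbalanced (fun (y : tpow H m) v2 => expand x y (op v1 v2)).
Proof.
split=> [v2 y y'|y v v'|y h v]; first exact: pseudoprod_expandDr.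
  by rewrite (pbilinDr opB) (pliftD (pseudoprod_balanced0 _ _)).
rewrite -[v1 in RHS]scale1r (pbilinZ opB) pseudoprod_expandZ.
by rewrite icomul_1 mulr1.
Qed.

Lemma pseudoprod_balanced2 (Y : pten m V2) : pbalanced (fun (x : tpow H n) v1 =>
  plift (fun y v2 => expand x y (op v1 v2)) Y).
Proof.
split=> [v1 x x'|x v v'|x h v].
- rewrite /plift -btens_lift_addf; apply: eq_btens_lift => y v2.
  exact: pseudoprod_expandDl.
- rewrite /plift -btens_lift_addf; apply: eq_btens_lift => y v2.
  rewrite (pbilinDl opB); exact: (pliftD (pseudoprod_balanced0 x y)).
- apply: eq_btens_lift => y v2.
  by rewrite -[v2 in RHS]scale1r (pbilinZ opB) pseudoprod_expandZ icomul_1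
    mulr1.
Qed.

(* pseudoprod does not depend on the choice of representatives. *)
Lemma pseudoprod_pure x v1 y v2 :
  pseudoprod op (x \oxH v1 : pten n V1) (y \oxH v2 : pten m V2) =
  plift (fun (g : tpow H 1) (w : V3) => (tcat x y * icomul2 n m g) \oxH w)
    (op v1 v2).
Proof.
by rewrite /pseudoprod (plift_pure (pseudoprod_balanced2 _))
  (plift_pure (pseudoprod_balanced1 _ _)).
Qed.

Lemma pseudoprodDl (X X' : pten n V1) (Y : pten m V2) :
  pseudoprod op (X + X') Y = pseudoprod op X Y + pseudoprod op X' Y.
Proof. exact: (pliftD (pseudoprod_balanced2 Y)). Qed.

Lemma pseudoprodDr (X : pten n V1) (Y Y' : pten m V2) :
  pseudoprod op X (Y + Y') = pseudoprod op X Y + pseudoprod op X Y'.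
Proof.
rewrite /pseudoprod /plift -btens_lift_addf; apply: eq_btens_lift => x v1.
exact: (pliftD (pseudoprod_balanced1 x v1)).
Qed.

Lemma pseudoprod_expand_pure x y g w : expand x y (g \oxH w : pten 1 V3) =
  (tcat x y * icomul2 n m g) \oxH w.
Proof. exact: (plift_pure (pseudoprod_balanced0 x y)). Qed.

End CompositionRule.

Section Chom.
Variables (F : fieldType) (H : hopfType F) (M N : lmodType H).

(* As in pbilinear, F-homogeneity is the case h = c%:A. *)
Definition pseudolinear (f : M -> pten 1 N) : Prop :=
  {morph f : u v / u + v} /\
  forall (h : H) u, f (h *: u) = ((1 \ox h) : tpow H 1) *: f u.

Definition pseudolinearb : {pred M -> pten 1 N} :=
  fun f => `[< pseudolinear f >].

Record Chom := MkChom {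
  chom_fun :> M -> pten 1 N;
  chom_funP : chom_fun \in pseudolinearb
}.

HB.instance Definition _ := [isSub for chom_fun].
HB.instance Definition _ := [Choice of Chom by <:].

Lemma pseudolinear_zmod_closed : zmod_closed pseudolinearb.
Proof.
split; first by apply/asboolP; split=> [u v|h u]; rewrite /= ?addr0 ?scaler0.
move=> f g /asboolP[fD fZ] /asboolP[gD gZ]; apply/asboolP.
split=> [u v|h u]; rewrite !fctE; first by rewrite fD gD opprD addrACA.
by rewrite fZ gZ scalerBr.
Qed.

HB.instance Definition _ :=
  GRing.isZmodClosed.Build _ pseudolinearb pseudolinear_zmod_closed.
HB.instance Definition _ := [SubChoice_isSubZmodule of Chom by <:].

Lemma chomP (phi : Chom) : pseudolinear phi.
Proof. by case: phi => f /= /asboolP. Qed.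

Lemma chom_ext (phi psi : Chom) : phi =1 psi -> phi = psi.
Proof. by move=> e; apply/val_inj/funext. Qed.

Lemma chomDE (phi psi : Chom) u : (phi + psi) u = phi u + psi u.
Proof. by []. Qed.

Lemma chom_scale_subproof (h : H) (phi : Chom) :
  (fun u => ((h \ox 1) : tpow H 1) *: phi u) \in pseudolinearb.
Proof.
have [phiD phiZ] := chomP phi.
apply/asboolP; split=> [u v|g u]; first by rewrite phiD scalerDr.
rewrite phiZ !scalerA; congr (_ *: _).
by rewrite [LHS]tpureM [RHS]tpureM !mul1r !mulr1.
Qed.

Definition chom_scale (h : H) (phi : Chom) : Chom :=
  MkChom (chom_scale_subproof h phi).

Lemma chom_scaleA a b phi :
  chom_scale a (chom_scale b phi) = chom_scale (a * b) phi.
Proof.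
apply: chom_ext => u /=; rewrite scalerA; congr (_ *: _).
by rewrite [LHS]tpureM mulr1.
Qed.

Lemma chom_scale1 : left_id 1 chom_scale.
Proof. by move=> phi; apply: chom_ext => u /=; exact: scale1r. Qed.

Lemma chom_scaleDr : right_distributive chom_scale +%R.
Proof.
by move=> h phi psi; apply: chom_ext => u; rewrite chomDE /= -scalerDr.
Qed.

Lemma chom_scaleDl phi : {morph chom_scale^~ phi : a b / a + b}.
Proof.
move=> a b; apply: chom_ext => u; rewrite chomDE /= -scalerDl.
by congr (_ *: _); exact: tpureDl.
Qed.

HB.instance Definition _ := GRing.Zmodule_isLmodule.Build H Chom
  chom_scaleA chom_scale1 chom_scaleDr chom_scaleDl.

Definition chom_eval : Chom -> M -> pten 1 N := chom_fun.

Lemma chom_eval_pbilinear : pbilinear chom_eval.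
Proof.
split=> [u phi psi|phi|h g phi u]; first exact: chomDE.
  exact: (chomP phi).1.
rewrite /chom_eval /= (chomP phi).2 scalerA; congr (_ *: _).
by rewrite [LHS]tpureM mul1r mulr1.
Qed.

End Chom.

Section Pseudoalgebra.
Variables (F : fieldType) (H : hopfType F).

Definition finite_module (M : lmodType H) : Prop :=
  exists (n : nat) (e : 'I_n -> M),
    forall u, exists c : 'I_n -> H, u = \sum_i c i *: e i.

Record assoc_pseudoalgebra (A : lmodType H) (mulA : A -> A -> pten 1 A) :
    Prop := AssocPseudoalgebra {
  pseudoalg_bilin : pbilinear mulA;
  pseudoalg_assoc : forall a b c,
    pseudoprod mulA (mulA a b) (pone c) = pseudoprod mulA (pone a) (mulA b c)
}.

Record left_module (A : lmodType H) (mulA : A -> A -> pten 1 A)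
    (M : lmodType H) (lact : A -> M -> pten 1 M) : Prop := LeftModule {
  lmodule_bilin : pbilinear lact;
  lmodule_assoc : forall a b u,
    pseudoprod lact (mulA a b) (pone u) = pseudoprod lact (pone a) (lact b u)
}.

Record right_module (A : lmodType H) (mulA : A -> A -> pten 1 A)
    (M : lmodType H) (ract : M -> A -> pten 1 M) : Prop := RightModule {
  rmodule_bilin : pbilinear ract;
  rmodule_assoc : forall u a b,
    pseudoprod ract (ract u a) (pone b) = pseudoprod ract (pone u) (mulA a b)
}.

Record bimodule (A : lmodType H) (mulA : A -> A -> pten 1 A)
    (M : lmodType H) (lact : A -> M -> pten 1 M)
    (ract : M -> A -> pten 1 M) : Prop := Bimodule {
  bimodule_left : left_module mulA lact;
  bimodule_right : right_module mulA ract;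
  bimodule_assoc : forall a u b,
    pseudoprod ract (lact a u) (pone b) = pseudoprod lact (pone a) (ract u b)
}.

End Pseudoalgebra.

(* Main.v *)
(* The map f (x) G (x)_H v |-> (f (x) 1)(Delta (x) id)(G) (x)_H v is an        *)
(* isomorphism from H (x) (H^(n+1) (x)_H V) onto H^(n+2) (x)_H V, natural for *)
(* the left argument of the composition rule. Applying linear functionals to  *)
(* the first factor split off in this way shows by induction that an element  *)
(* X of H^n (x)_H Chom(M, N) is determined by u |-> X * u. Conversely,        *)
(* u |-> a * (phi * u) and u |-> phi * (a * u) intertwine h with              *)
(* 1 (x) 1 (x) h, which leaves the first factor alone; so the first factors   *)
(* of their values lie in the span of those at finitely many generators of M, *)
(* and the coordinates in this finite-dimensional span are pseudolinear maps, *)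
(* which give X. The module axioms are then checked after evaluation at u,    *)
(* where they follow from those of M and N.                                   *)

Require Import Defs.
From HB Require Import structures.
From mathcomp Require Import all_boot all_order all_algebra.
From mathcomp Require Import boolp.

Set Implicit Arguments.
Unset Strict Implicit.
Unset Printing Implicit Defensive.

Import GRing.Theory.
Local Open Scope ring_scope.

(** The actions are prescribed by their values at every [u] in [M], so everything rests on knowing
    when a map [T] from [M] to [H^3 (x)_H N] is evaluation of some [X] in [H^2 (x)_H Chom(M, N)],
    and that [X] is then unique. The shear [f (x) g |-> f g1 (x) g2], inverted by means of the
    antipode ([shearK]), converts right multiplication by [1 (x) Delta(h)] into that by the next
    iterated coproduct. Hence [H^(n+2) (x)_H V] is [H (x) (H^(n+1) (x)_H V)] over the ground field:
    [ins] is this isomorphism and [peel l] a coordinate of its inverse. Uniqueness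
    ([chom_tensor_ext]) follows by induction, since coordinates commute with evaluation. Existence
    ([chom_tensor_exists]) uses that the values of [T] at generators of [M] have first factors in a
    finite-dimensional space; the coordinates of [T] there lie in [Chom(M, N)]. The axioms are
    equalities between elements determined by evaluation. Evaluating them calls for associativity of
    the composition rule in higher tensor degrees ([pseudoprodA_pone], [pseudoprodA_tpow1]), deduced
    from associativity on single vectors; the axioms of [M] and [N] then conclude. *)

(** A vector [v] not yet reproduced by the expansion [P] contributes its defect [v - P v], with the
    functional [x |-> f (x - P x)], which vanishes on every vector already reproduced. *)
Lemma finite_coordinates (F : fieldType) (V : lmodType F) (s : seq V) :
  exists d : seq (V * {scalar V}),
    forall x, x \in s -> x = \sum_(p <- d) p.2 x *: p.1.
Proof.
elim: s => [|v s [d dP]]; first by exists [::].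
pose P x := \sum_(p <- d) p.2 x *: p.1.
have [r0|r_neq0] := eqVneq (v - P v) 0.
  exists d => x; rewrite inE => /predU1P[->|/dP//].
  by apply/eqP; rewrite -subr_eq0 r0.
have PL c x y : P (c *: x + y) = c *: P x + P y.
  rewrite scaler_sumr -big_split; apply: eq_bigr => p _.
  by rewrite linearP scalerDl scalerA.
have [f [fD fZ f1]] := exists_functional r_neq0.
pose l x := f (x - P x).
have lL : linear_for *%R l.
  by move=> c x y; rewrite /l PL opprD addrACA -scalerBr fD fZ.
have f0 : f 0 = 0 by apply: (addrI (f 0)); rewrite -fD !addr0.
pose l' : {scalar V} := HB.pack l (GRing.isLinear.Build F V F *%R l lL).
exists ((v - P v, l') :: d) => x.
rewrite inE big_cons -/(P x) /= /l => /predU1P[->|/dP xP].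
  by rewrite f1 scale1r subrK.
by rewrite /P -xP subrr f0 scale0r add0r.
Qed.

(** * Shear maps on tensor powers and their inverses *)

Section Shear.
Variables (F : fieldType) (H : hopfType F).

Section OnFirst.
Variable c : H -> tpow H 1.
Hypothesis cL : linear c.

Definition on_first n : tpow H n -> tpow H n.+1 :=
  match n return tpow H n -> tpow H n.+1 with
  | 0%N => c
  | n'.+1 => tlift (fun (g : H) G => @tcat F H 1 n' (c g) G)
  end.

Lemma on_first_bilinear n :
  bilinear_map (fun (g : H) (G : tpow H n) => tcat (c g) G).
Proof.
have [tl tr] := tcat_bilinear H 1 n.
by split=> [G|g]; [move=> a g g'; rewrite cL; exact: tl | exact: tr].
Qed.

Lemma on_first_linear n : linear (@on_first n).
Proof.
by case: n => [|n]; [exact: cL|exact: (tlift_linear (on_first_bilinear n))].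
Qed.

Lemma on_first_pure n (g : H) (G : tpow H n) :
  @on_first n.+1 (g \ox G) = tcat (c g) G.
Proof. exact: (tlift_pure (on_first_bilinear n)). Qed.

Lemma on_firstD n : {morph @on_first n : x y / x + y}.
Proof. by move=> x y; have := on_first_linear 1 x y; rewrite !scale1r. Qed.

Lemma on_first0 n : @on_first n 0 = 0.
Proof. by apply: (addrI (@on_first n 0)); rewrite -on_firstD !addr0. Qed.

Lemma on_firstZ n a (x : tpow H n) : on_first (a *: x) = a *: on_first x.
Proof.
by have := on_first_linear a x 0; rewrite on_first0 !addr0.
Qed.

(** For [c := comul] this is the Galois map [f (x) g |-> f g1 (x) g2] on the first two factors; for
    [c := acomul] it is [f (x) g |-> f S(g1) (x) g2]. *)
Definition shear n (x : tpow H n.+1) : tpow H n.+1 :=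
  tlift (fun (f : H) (G : tpow H n) => (f \ox 1 : tpow H n.+1) * on_first G) x.

Lemma shear_bilinear n : bilinear_map (fun (f : H) (G : tpow H n) =>
  (f \ox 1 : tpow H n.+1) * on_first G).
Proof.
split=> [G|f] a x y; first by rewrite tpureDl tpureZl mulrDl scalerAl.
by rewrite on_first_linear mulrDr scalerAr.
Qed.

Lemma shear_pure n (f : H) (G : tpow H n) :
  shear (f \ox G) = (f \ox 1 : tpow H n.+1) * on_first G.
Proof. exact: (tlift_pure (shear_bilinear n)). Qed.

Lemma shearD n : {morph @shear n : x y / x + y}.
Proof. exact: (tliftD (shear_bilinear n)). Qed.

Lemma shear0 n : @shear n 0 = 0.
Proof. exact: (tlift0 (shear_bilinear n)). Qed.

Lemma shearMl n (f : H) (x : tpow H n.+1) :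
  shear ((f \ox 1 : tpow H n.+1) * x) = (f \ox 1 : tpow H n.+1) * shear x.
Proof.
elim/(@tprod_ind F H (tpow H n)): x => [|g G|x y hx hy].
- by rewrite mulr0 shear0 mulr0.
- by rewrite [X in shear X]tpureM mul1r !shear_pure mulrA [in RHS]tpureM mulr1.
- by rewrite mulrDr !shearD hx hy mulrDr.
Qed.

Lemma shear_tcat n (x : tpow H 1) (G : tpow H n) :
  @shear n.+1 (tcat x G) = tcat (@shear 0 x) G.
Proof.
elim/(@tprod_ind F H H): x => [|f g|x y hx hy].
- by rewrite tcat0l !shear0 tcat0l.
- rewrite tcatS shear_pure [@shear 0 _]shear_pure on_first_pure.
  rewrite -{2}[G]mul1r tcat_mulr; congr (_ * _).
  by rewrite tcatS; congr (_ \ox _).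
- by rewrite tcatDl !shearD hx hy tcatDl.
Qed.

End OnFirst.

(** A shear commutes with left multiplication on the first factor and leaves the factors from the
    third on alone, so cancellation need only be known on [1 (x) h]. *)
Lemma shearK (c d : H -> tpow H 1) : linear c -> linear d ->
  (forall h, @shear c 0 (d h) = 1 \ox h) ->
  forall n, cancel (@shear d n) (@shear c n).
Proof.
move=> cL dL cd n x; elim/(@tprod_ind F H (tpow H n)): x => [|f G|x y hx hy].
- by rewrite !shear0.
- rewrite shear_pure // shearMl //.
  suff -> : shear c (on_first d G) = 1 \ox G.
    by rewrite [LHS]tpureM mulr1 mul1r.
  case: n G => [//|n]; elim/(@tprod_ind F H (tpow H n)) => [|g G|x y hx hy].
  + rewrite on_first0 // shear0 //.
    by apply: (addrI (1 \ox 0)); rewrite -tpureDr !addr0.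
  + by rewrite on_first_pure // shear_tcat // cd tcatS.
  + by rewrite on_firstD // shearD // hx hy tpureDr.
- by rewrite !shearD // hx hy.
Qed.

Lemma comul_linear : linear (comul : H -> tpow H 1).
Proof. by move=> a x y; exact: linearP. Qed.

(* S(h1) (x) h2 *)
Definition acomul (h : H) : tpow H 1 :=
  tlift (fun a b : H => antipode a \ox b) (comul h).

Lemma acomul_bilinear : bilinear_map (fun a b : H => antipode a \ox b).
Proof.
split=> [b|a] c x y; first by rewrite linearP tpureDl tpureZl.
by rewrite tpureDr tpureZr.
Qed.

Lemma acomul_linear : linear acomul.
Proof.
by move=> a x y; rewrite /acomul linearP; exact: (tlift_lin acomul_bilinear).
Qed.

(* h1 m h2 (x) h3 = 1 (x) h as soon as h1 m h2 = eps(h) *)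
Lemma convolution_comul (m : H -> H -> H) : bilinear_map m ->
  (forall h, tlift m (comul h) = (counit h : F)%:A) ->
  forall h, tlift (fun a b => tlift (fun a' b' => m a a' \ox b') (comul b))
    (comul h) = 1 \ox h.
Proof.
move=> mB m_eps h.
have B1 a : bilinear_map (fun a' b' : H => m a a' \ox b').
  split=> [b|b] c x y; first by rewrite mB.2 tpureDl tpureZl.
  by rewrite tpureDr tpureZr.
pose L (x : tpow H 2) : tprod H H :=
  tlift (fun (a : H) (y : tprod H H) => tlift (fun a' b' => m a a' \ox b') y) x.
have LB : bilinear_map (fun (a : H) (y : tprod H H) =>
    tlift (fun a' b' => m a a' \ox b') y).
  split=> [y|a]; last exact: tlift_linear.
  by apply: tlift_linear_fun => a' b' c x z; rewrite mB.1 tpureDl tpureZl.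
have LD x y : L (x + y) = L x + L y by exact: (tliftD LB).
have L0 : L 0 = 0 by exact: (tlift0 LB).
have cB : bilinear_map (fun g g' : H => @tcat F H 0 1 g (comul g')).
  split=> [b|a] c x y; first exact: (tcat_bilinear H 0 1).1.
  by rewrite linearP; exact: (tcat_bilinear H 0 1).2.
have LcB : bilinear_map (fun a b : H =>
    tlift (fun a' b' => m a a' \ox b') (comul b)).
  split=> [b|a] c x y; first exact: LB.1.
  by rewrite linearP; exact: LB.2.
have cB' := on_first_bilinear comul_linear 0.
(* [L] combines the first two of three factors by [m]. Coassociativity moves the second coproduct to
   the first leg, where [m_eps] produces a counit that is absorbed by [counitl]. *)
transitivity (L (tlift (fun g g' => @tcat F H 0 1 g (comul g')) (comul h))).
  elim/tprod_ind: (comul h) => [|a b|x y hx hy].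
  - by rewrite (tlift0 cB) L0 (tlift0 LcB).
  - by rewrite (tlift_pure cB) (tlift_pure LcB) /L (tlift_pure LB).
  - by rewrite (tliftD cB) (tliftD LcB) LD hx hy.
rewrite -coassoc -[in RHS](counitl h).
have eB : bilinear_map (fun g g' : H => (counit g : F) *: g').
  split=> [b|a] c x y; first by rewrite linearP scalerDl scalerA.
  by rewrite scalerDr !scalerA mulrC.
elim/tprod_ind: (comul h) => [|a b|x y hx hy].
- rewrite (tlift0 cB') (tlift0 eB) L0.
  by apply: (addrI (1 \ox 0)); rewrite -tpureDr !addr0.
- rewrite (tlift_pure cB') (tlift_pure eB) -tpureZ -m_eps.
  elim/tprod_ind: (comul a) => [|a1 a2|x y hx hy].
  + rewrite tcat0l L0 (tlift0 mB).
    by apply: (addrI (0 \ox b)); rewrite -tpureDl !addr0.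
  + by rewrite (tlift_pure mB) tcatS /L (tlift_pure LB) (tlift_pure (B1 _)).
  + by rewrite tcatDl LD hx hy (tliftD mB) tpureDl.
- by rewrite (tliftD cB') (tliftD eB) LD hx hy tpureDr.
Qed.

(** The left side is [S(h1) h2 (x) h3], which the left antipode axiom collapses. *)
Lemma shear_acomul (h : H) : @shear comul 0 (acomul h) = 1 \ox h.
Proof.
have mB : bilinear_map (fun a b : H => antipode a * b).
  split=> [b|a] c x y; first by rewrite linearP mulrDl scalerAl.
  by rewrite mulrDr scalerAr.
rewrite -(convolution_comul mB (@antipodel F H) h) /acomul.
have B2 : bilinear_map (fun a b : H =>
    tlift (fun a' b' => (antipode a * a') \ox b') (comul b)).
  split=> [b|a] c x y.
    apply: (@tlift_linear_fun F H H (tprod H H) H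
      (fun a a' b' => (antipode a * a') \ox b')) => a' b' d u v.
    by rewrite linearP mulrDl tpureDl -scalerAl tpureZl.
  rewrite linearP; apply: tlift_linear; split=> [b'|a'] d u v.
    by rewrite mulrDr tpureDl -scalerAr tpureZl.
  by rewrite tpureDr tpureZr.
elim/tprod_ind: (comul h) => [|a b|x y hx hy].
- by rewrite (tlift0 acomul_bilinear) (tlift0 B2) (shear0 comul_linear).
- rewrite (tlift_pure acomul_bilinear) (tlift_pure B2).
  rewrite (shear_pure comul_linear) /=.
  have B3 : bilinear_map (fun a' b' : H => (antipode a * a') \ox b').
    split=> [b'|a'] d u v; first by rewrite mulrDr tpureDl -scalerAr tpureZl.
    by rewrite tpureDr tpureZr.
  elim/tprod_ind: (comul b) => [|b1 b2|x y hx hy].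
  + by rewrite mulr0 (tlift0 B3).
  + by rewrite (tlift_pure B3) tpureM mul1r.
  + by rewrite mulrDr (tliftD B3) hx hy.
- by rewrite (tliftD acomul_bilinear) (tliftD B2) (shearD comul_linear) hx hy.
Qed.

(** Here the left side is [h1 S(h2) (x) h3]: the two antipode axioms account for the two composites
    of the shears. *)
Lemma shear_comul (h : H) : @shear acomul 0 (comul h) = 1 \ox h.
Proof.
have mB : bilinear_map (fun a b : H => a * antipode b).
  split=> [b|a] c x y; first by rewrite mulrDl scalerAl.
  by rewrite linearP mulrDr scalerAr.
rewrite -(convolution_comul mB (@antipoder F H) h).
apply: eq_btens_lift => a b /=; rewrite /acomul.
have B3 : bilinear_map (fun a' b' : H => (a * antipode a') \ox b').
  split=> [b'|a'] d u v; last by rewrite tpureDr tpureZr.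
  by rewrite linearP mulrDr tpureDl -scalerAr tpureZl.
elim/tprod_ind: (comul b) => [|b1 b2|x y hx hy].
- by rewrite (tlift0 acomul_bilinear) mulr0 (tlift0 B3).
- by rewrite (tlift_pure acomul_bilinear) (tlift_pure B3) tpureM mul1r.
- by rewrite (tliftD acomul_bilinear) mulrDr (tliftD B3) hx hy.
Qed.

End Shear.

(** * Comultiplication of the first tensor factor *)

Section FirstFactorComul.
Variables (F : fieldType) (H : hopfType F).
Local Notation comul1 := (on_first (comul : H -> tpow H 1)).

Lemma on_first_comulM n : {morph @on_first F H comul n : x y / x * y}.
Proof.
case: n => [|n] x y; first exact: rmorphM.
have cL := @comul_linear F H.
elim/(@tprod_ind F H (tpow H n)): x => [|g G|x z hx hz].
- by rewrite mul0r on_first0 // mul0r.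
- elim/(@tprod_ind F H (tpow H n)): y => [|h K|y z hy hz].
  + by rewrite mulr0 on_first0 // mulr0.
  + rewrite [X in comul1 X]tpureM !(on_first_pure cL) rmorphM /=.
    exact: (@tcat_mulr F H 1 n (comul g) (comul h)).
  + by rewrite mulrDr !on_firstD // mulrDr hy hz.
- by rewrite mulrDl !on_firstD // mulrDl hx hz.
Qed.

(** The recursion of [icomul] expands on the right, so expanding the first factor is an instance of
    coassociativity, available as [icomul2_comul]. *)
Lemma on_first_comul_icomul n (h : H) : comul1 (icomul n h) = icomul n.+1 h.
Proof.
case: n => [|n]; first by rewrite icomul1.
have cL := @comul_linear F H.
have SB := @icomulS_bilinear F H n.
rewrite -(icomul2_comul 1 n h).
have -> : icomul n.+1 h =
  tlift (fun h1 h2 : H => h1 \ox icomul n h2) (comul h) by [].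
elim/tprod_ind: (comul h) => [|a b|x y hx hy].
- by rewrite (tlift0 SB) on_first0 // icomul2_0.
- by rewrite (tlift_pure SB) on_first_pure // icomul2_pure icomul1.
- by rewrite (tliftD SB) on_firstD // hx hy icomul2D.
Qed.

Lemma on_first_comul_tcat n m (x : tpow H n) (y : tpow H m) :
  comul1 (tcat x y) = @tcat F H n.+1 m (comul1 x) y.
Proof.
have cL := @comul_linear F H.
case: n x => [|n] x; first exact: on_first_pure.
elim/(@tprod_ind F H (tpow H n)): x => [|g G|x z hx hz].
- by rewrite tcat0l !on_first0 // tcat0l.
- rewrite tcatS !on_first_pure //.
  elim/tprod_ind: (comul g) => [|a b|u v hu hv].
  + by rewrite !tcat0l.
  + by rewrite !tcatS.
  + by rewrite !tcatDl hu hv.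
- by rewrite tcatDl !on_firstD // hx hz tcatDl.
Qed.

(** For [G = icomul n h] the factor on the right becomes [icomul n.+1 h]: up to the shear, [H] acts
    on a tensor power without touching its first factor. *)
Lemma shear_comulMr n (x : tpow H n.+1) (G : tpow H n) :
  shear comul (x * (1 \ox G)) = shear comul x * comul1 G.
Proof.
have cL := @comul_linear F H.
elim/(@tprod_ind F H (tpow H n)): x => [|f K|x y hx hy].
- by rewrite mul0r !shear0 // mul0r.
- by rewrite [X in shear _ X]tpureM mulr1 !shear_pure // on_first_comulM mulrA.
- by rewrite mulrDl !shearD // hx hy mulrDl.
Qed.

(** This is [shear_comulMr] conjugated by the inverse shear. *)
Lemma shear_acomulMr n (x : tpow H n.+1) (G : tpow H n) :
  shear (@acomul F H) (x * comul1 G) = shear (@acomul F H) x * (1 \ox G).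
Proof.
have cL := @comul_linear F H; have aL := @acomul_linear F H.
have ca := shearK cL aL (@shear_acomul F H).
have ac := shearK aL cL (@shear_comul F H).
by rewrite -[x in LHS]ca -shear_comulMr ac.
Qed.

End FirstFactorComul.

(** * Splitting off the first tensor factor *)

Section Peel.
Variables (F : fieldType) (H : hopfType F) (V : lmodType H).
Let cL := @comul_linear F H.
Let aL := @acomul_linear F H.

Definition ins n (f : H) : pten n V -> pten n.+1 V :=
  plift (fun (G : tpow H n) v =>
    ((f \ox 1 : tpow H n.+1) * on_first comul G) \oxH v).

Lemma ins_balanced n (f : H) : pbalanced (fun (G : tpow H n) (v : V) =>
  ((f \ox 1 : tpow H n.+1) * on_first comul G) \oxH v).
Proof.
split=> [v G K|G v w|G h v].
- by rewrite on_firstD // mulrDr ppureDl.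
- exact: ppureDr.
- by rewrite on_first_comulM on_first_comul_icomul mulrA ppure_bal.
Qed.

Lemma ins_pure n f (G : tpow H n) v :
  ins f (G \oxH v : pten n V) =
  ((f \ox 1 : tpow H n.+1) * on_first comul G) \oxH v.
Proof. exact: (plift_pure (@ins_balanced n f)). Qed.

Lemma insD n f : {morph @ins n f : X Y / X + Y}.
Proof. exact: (pliftD (@ins_balanced n f)). Qed.

Lemma ins0 n f : @ins n f 0 = 0.
Proof. exact: (plift0 (@ins_balanced n f)). Qed.

Lemma insDl n (X : pten n V) : {morph (@ins n)^~ X : f g / f + g}.
Proof.
move=> f g; elim/pten_ind: X => [|G v|X Y hX hY].
- by rewrite !ins0 addr0.
- by rewrite !ins_pure tpureDl mulrDl ppureDl.
- by rewrite !insD hX hY addrACA.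
Qed.

Lemma ins0l n (X : pten n V) : ins 0 X = 0.
Proof. by apply: (addrI (ins 0 X)); rewrite -insDl !addr0. Qed.

Lemma insZl n c f (X : pten n V) : ins (c *: f) X = ins f (c%:A *: X).
Proof.
elim/pten_ind: X => [|G v|X Y hX hY].
- by rewrite scaler0 !ins0.
- rewrite -ppureZ !ins_pure mulr_algl on_firstZ // tpureZl.
  by rewrite -scalerAl scalerAr.
- by rewrite scalerDr !insD hX hY.
Qed.

(** A coefficient with first factor [1] keeps it under comultiplication, and so commutes with [f] in
    the first position. *)
Lemma insZ1 n f (K : tpow H n) (X : pten n.+1 V) :
  ins f ((1 \ox K : tpow H n.+1) *: X) =
  (1 \ox (1 \ox K) : tpow H n.+2) *: ins f X.
Proof.
have E : (f \ox 1 : tpow H n.+2) * on_first comul (1 \ox K : tpow H n.+1) =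
    (1 \ox (1 \ox K) : tpow H n.+2) * (f \ox 1).
  rewrite on_first_pure // rmorph1.
  have -> : tcat (1 : tpow H 1) K = 1 \ox (1 \ox K).
    exact: (@tcatS F H 0 n 1 1 K).
  by rewrite [LHS]tpureM [RHS]tpureM !mulr1 !mul1r.
elim/pten_ind: X => [|G v|X Y hX hY].
- by rewrite scaler0 !ins0 scaler0.
- by rewrite -ppureZ !ins_pure on_first_comulM mulrA E -mulrA ppureZ.
- by rewrite scalerDr !insD hX hY scalerDr.
Qed.

Definition eval_first n (l : {scalar H}) (x : tpow H n.+1) : tpow H n :=
  tlift (fun (f : H) (G : tpow H n) => l f *: G) x.

Lemma eval_first_bilinear n (l : {scalar H}) :
  bilinear_map (fun (f : H) (G : tpow H n) => l f *: G).
Proof.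
split=> [G|f] a x y; first by rewrite linearP scalerDl scalerA.
by rewrite scalerDr !scalerA mulrC.
Qed.

Lemma eval_first_pure n l (f : H) (G : tpow H n) :
  eval_first l (f \ox G) = l f *: G.
Proof. exact: (tlift_pure (@eval_first_bilinear n l)). Qed.

Lemma eval_firstD n l : {morph @eval_first n l : x y / x + y}.
Proof. exact: (tliftD (@eval_first_bilinear n l)). Qed.

Lemma eval_firstMr n l (x : tpow H n.+1) (G : tpow H n) :
  eval_first l (x * (1 \ox G)) = eval_first l x * G.
Proof.
elim/(@tprod_ind F H (tpow H n)): x => [|f K|x y hx hy].
- by rewrite mul0r /eval_first (tlift0 (@eval_first_bilinear n l)) mul0r.
- by rewrite [X in eval_first _ X]tpureM mulr1 !eval_first_pure scalerAl.
- by rewrite mulrDl !eval_firstD hx hy mulrDl.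
Qed.

(* The coordinate along l of the inverse (f (x) g (x) K) (x)_H v |->          *)
(* f S(g1) (x) ((g2 (x) K) (x)_H v) of f (x) X |-> ins f X.                   *)
Definition peel n (l : {scalar H}) : pten n.+1 V -> pten n V :=
  plift (fun x v => eval_first l (shear (@acomul F H) x) \oxH v).

(** The inverse shear turns right multiplication by [icomul n.+1 h] into that by [1 (x) icomul n h],
    and the functional [l] only sees the first factor. *)
Lemma peel_balanced n l : pbalanced (fun (x : tpow H n.+1) (v : V) =>
  eval_first l (shear (@acomul F H) x) \oxH v).
Proof.
split=> [v x y|x v w|x h v].
- by rewrite shearD // eval_firstD ppureDl.
- exact: ppureDr.
- rewrite -on_first_comul_icomul shear_acomulMr eval_firstMr.
  exact: ppure_bal.
Qed.

Lemma peelD n l : {morph @peel n l : X Y / X + Y}.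
Proof. exact: (pliftD (@peel_balanced n l)). Qed.

Lemma peel0 n l : @peel n l 0 = 0.
Proof. exact: (plift0 (@peel_balanced n l)). Qed.

(** On pure tensors [ins f] is the shear by [comul], which the shear inside [peel] undoes. *)
Lemma peel_ins n l f (X : pten n V) : peel l (ins f X) = (l f)%:A *: X.
Proof.
elim/pten_ind: X => [|G v|X Y hX hY].
- by rewrite ins0 peel0 scaler0.
- rewrite ins_pure /peel (plift_pure (@peel_balanced n l)) -shear_pure //.
  rewrite (shearK aL cL (@shear_comul F H)).
  by rewrite eval_first_pure -ppureZ mulr_algl.
- by rewrite insD peelD hX hY scalerDr.
Qed.

(** The shear is surjective, and a preimage is a sum of tensors [f (x) G]. *)
Lemma ins_spanning n (X : pten n.+1 V) :
  exists s : seq (H * pten n V), X = \sum_(p <- s) ins p.1 p.2.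
Proof.
elim/pten_ind: X => [|x v|X Y [s ->] [t ->]].
- by exists [::]; rewrite big_nil.
- rewrite -[x](shearK cL aL (@shear_acomul F H)).
  elim/(@tprod_ind F H (tpow H n)): (shear _ x) => [|f G|y z [s ys] [t zt]].
  + exists [::]; rewrite big_nil shear0 //.
    by apply: (addrI (0 \oxH v)); rewrite -ppureDl !addr0.
  + by exists [:: (f, G \oxH v)]; rewrite big_seq1 ins_pure shear_pure.
  + by exists (s ++ t); rewrite shearD // ppureDl ys zt big_cat.
- by exists (s ++ t); rewrite big_cat.
Qed.

Lemma ins_ind n (Q : pten n.+1 V -> Prop) :
  Q 0 -> (forall f X, Q (ins f X)) ->
  (forall X Y, Q X -> Q Y -> Q (X + Y)) -> forall X, Q X.
Proof.
move=> Q0 Qi QD X; have [s ->] := ins_spanning X.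
by elim/big_ind: _ => //.
Qed.

End Peel.

(** * Single vectors and their products in higher degree *)

Section Pone.
Variables (F : fieldType) (H : hopfType F) (V : lmodType H).

Lemma poneD : {morph @pone F H V : u v / u + v}.
Proof. exact: ppureDr. Qed.

Lemma pone0 : @pone F H V 0 = 0.
Proof. by apply: (addrI (pone 0)); rewrite -poneD !addr0. Qed.

Lemma poneZ (h : H) (v : V) : pone (h *: v) = (h : tpow H 0) *: pone v.
Proof. by rewrite /pone -ppureZ mulr1 -ppure_bal mul1r. Qed.

Lemma pone_surj (X : pten 0 V) : exists v, X = pone v.
Proof.
elim/pten_ind: X => [|x v|_ _ [u ->] [v ->]].
- by exists 0; rewrite pone0.
- by exists ((x : H) *: v); rewrite poneZ -ppureZ mulr1.
- by exists (u + v); rewrite poneD.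
Qed.

Lemma spread_balanced m k : pbalanced (fun (g : tpow H 1) (v : V) =>
  icomul2 m k g \oxH v).
Proof.
split=> [v g g'|g v w|g h v].
- by rewrite icomul2D ppureDl.
- exact: ppureDr.
- by rewrite icomul1 icomul2M icomul2_comul ppure_bal.
Qed.

(** The product of [1 (x)_H v] and [1 (x)_H w] in degrees [m] and [k], as a function of [v * w]
    alone; see [pseudoprod_spread]. *)
Definition spread m k : pten 1 V -> pten (m + k).+1 V :=
  plift (fun (g : tpow H 1) (v : V) => icomul2 m k g \oxH v).

Lemma spread_pure m k (g : tpow H 1) (v : V) :
  spread m k (g \oxH v) = icomul2 m k g \oxH v.
Proof. exact: (plift_pure (@spread_balanced m k)). Qed.

Lemma spreadD m k : {morph spread m k : X Y / X + Y}.
Proof. exact: (pliftD (@spread_balanced m k)). Qed.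

Lemma spread0 m k : spread m k 0 = 0.
Proof. exact: (plift0 (@spread_balanced m k)). Qed.

Lemma spread00 (X : pten 1 V) : spread 0 0 X = X.
Proof.
elim/pten_ind: X => [|g v|X Y hX hY]; first exact: spread0.
  rewrite spread_pure; congr (_ \oxH _).
  elim/(@tprod_ind F H H): g => [|a b|x y hx hy]; first exact: icomul2_0.
    exact: icomul2_pure.
  by rewrite icomul2D [in RHS]/= -[in RHS]hx -[in RHS]hy.
by rewrite spreadD -[in RHS]hX -[in RHS]hY.
Qed.

End Pone.

Section Expand.
Variables (F : fieldType) (H : hopfType F) (V : lmodType H) (n m : nat).
Variables (x : tpow H n) (y : tpow H m).
Let expand :=
  plift (fun (g : tpow H 1) (w : V) => (tcat x y * icomul2 n m g) \oxH w).

Lemma pseudoprod_expandD : {morph expand : Z Z' / Z + Z'}.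
Proof. exact: (pliftD (@pseudoprod_balanced0 F H V n m x y)). Qed.

Lemma pseudoprod_expand0 : expand 0 = 0.
Proof. exact: (plift0 (@pseudoprod_balanced0 F H V n m x y)). Qed.

End Expand.

(** * Linearity of the composition rule and its compatibility with splitting *)

Section PseudoprodTheory.
Variables (F : fieldType) (H : hopfType F) (V1 V2 V3 : lmodType H).
Variable op : V1 -> V2 -> pten 1 V3.
Hypothesis opB : pbilinear op.

Lemma pseudoprod0l n m (Y : pten m V2) : pseudoprod op (0 : pten n V1) Y = 0.
Proof.
apply: (addrI (pseudoprod op (0 : pten n V1) Y)).
by rewrite -(pseudoprodDl opB) !addr0.
Qed.

Lemma pseudoprod0r n m (X : pten n V1) : pseudoprod op X (0 : pten m V2) = 0.
Proof.
apply: (addrI (pseudoprod op X (0 : pten m V2))).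
by rewrite -(pseudoprodDr opB) !addr0.
Qed.

Lemma pseudoprodZ n m (x : tpow H n) (y : tpow H m) X Y :
  pseudoprod op (x *: X : pten n V1) (y *: Y : pten m V2) =
  tcat x y *: pseudoprod op X Y.
Proof.
elim/pten_ind: X => [|x' v|X X' hX hX'].
- by rewrite scaler0 !pseudoprod0l scaler0.
- elim/pten_ind: Y => [|y' w|Y Y' hY hY'].
  + by rewrite scaler0 !pseudoprod0r scaler0.
  + rewrite -!ppureZ !(pseudoprod_pure opB).
    elim/pten_ind: (op v w) => [|g u|Z Z' hZ hZ'].
    * by rewrite !pseudoprod_expand0 scaler0.
    * by rewrite !pseudoprod_expand_pure tcat_mulr -mulrA ppureZ.
    * by rewrite !pseudoprod_expandD hZ hZ' scalerDr.
  + by rewrite scalerDr !(pseudoprodDr opB) hY hY' scalerDr.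
- by rewrite scalerDr !(pseudoprodDl opB) hX hX' scalerDr.
Qed.

Lemma pseudoprodZl n m c (X : pten n V1) (Y : pten m V2) :
  pseudoprod op (c%:A *: X) Y = c%:A *: pseudoprod op X Y.
Proof.
rewrite -[Y in LHS]scale1r pseudoprodZ; congr (_ *: _).
have := (tcat_bilinear H n m).1 1 c 1 0.
by rewrite tcat0l tcat11 !addr0.
Qed.

Lemma pseudoprod_spread m k (v : V1) (w : V2) :
  pseudoprod op (1 \oxH v : pten m V1) (1 \oxH w : pten k V2) =
  spread m k (op v w).
Proof.
rewrite (pseudoprod_pure opB); apply: eq_btens_lift => g u.
by rewrite tcat11 mul1r.
Qed.

Lemma pseudoprod_pone (v : V1) (w : V2) :
  pseudoprod op (pone v) (pone w) = op v w.
Proof. by rewrite pseudoprod_spread spread00. Qed.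

(** Comultiplying the first factor after the composition rule amounts to replacing [icomul2 n m] by
    [icomul2 n.+1 m], which is what the rule prescribes for a left argument with one more factor. *)
Lemma pseudoprod_ins n m f (X : pten n V1) (Y : pten m V2) :
  pseudoprod op (ins f X) Y = ins f (pseudoprod op X Y).
Proof.
elim/pten_ind: X => [|x v|X X' hX hX'].
- by rewrite ins0 !pseudoprod0l ins0.
- elim/pten_ind: Y => [|y w|Y Y' hY hY'].
  + by rewrite !pseudoprod0r ins0.
  + rewrite ins_pure !(pseudoprod_pure opB).
    elim/pten_ind: (op v w) => [|g u|Z Z' hZ hZ'].
    * by rewrite !pseudoprod_expand0 ins0.
    * rewrite !pseudoprod_expand_pure ins_pure; congr (_ \oxH _).
      rewrite on_first_comulM on_first_comul_tcat mulrA; congr (_ * _).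
        rewrite -[y in LHS]mul1r tcat_mulr; congr (_ * _).
        by rewrite tcatS tcat11.
      elim/(@tprod_ind F H H): g => [|a b|s t hs ht].
      - by rewrite !icomul2_0 on_first0 //; exact: comul_linear.
      - by rewrite !icomul2_pure on_first_comul_tcat on_first_comul_icomul.
      - by rewrite !icomul2D on_firstD ?hs ?ht //; exact: comul_linear.
    * by rewrite !pseudoprod_expandD hZ hZ' insD.
  + by rewrite !(pseudoprodDr opB) hY hY' insD.
- by rewrite insD !(pseudoprodDl opB) hX hX' insD.
Qed.

(** For [ins f X] in the left argument both sides are [l f] times the product of [X] and [Y]. This
    is what lets inductions on the degree strip one factor. *)
Lemma peel_pseudoprod n m l (X : pten n.+1 V1) (Y : pten m V2) :
  peel l (pseudoprod op X Y : pten (n + m).+2 V3) = pseudoprod op (peel l X) Y.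
Proof.
elim/ins_ind: X => [|f X|X X' hX hX'].
- by rewrite peel0 !pseudoprod0l peel0.
- by rewrite pseudoprod_ins !peel_ins pseudoprodZl.
- by rewrite (pseudoprodDl opB) !peelD (pseudoprodDl opB) hX hX'.
Qed.

End PseudoprodTheory.

(** * Iterated coproducts on the last two of three factors *)

Section SpreadTail.
Variables (F : fieldType) (H : hopfType F) (m k : nat).

(* id (x) icomul m (x) icomul k *)
Definition tail_icomul2 (x : tpow H 2) : tpow H (m + k).+2 :=
  tlift (fun (a : H) (g : tpow H 1) => a \ox icomul2 m k g) x.

Lemma tail_icomul2_bilinear :
  bilinear_map (fun (a : H) (g : tpow H 1) => a \ox icomul2 m k g).
Proof.
split=> [g|a] c x y; first by rewrite tpureDl tpureZl.
have -> : icomul2 m k (c *: x + y) = c *: icomul2 m k x + icomul2 m k y.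
  exact: (tlift_lin (icomul2_bilinear H m k)).
by rewrite tpureDr tpureZr.
Qed.

Lemma tail_icomul2_pure (a : H) (g : tpow H 1) :
  tail_icomul2 (a \ox g) = a \ox icomul2 m k g.
Proof. exact: (tlift_pure tail_icomul2_bilinear). Qed.

Lemma tail_icomul2D : {morph tail_icomul2 : x y / x + y}.
Proof. exact: (tliftD tail_icomul2_bilinear). Qed.

Lemma tail_icomul2_0 : tail_icomul2 0 = 0.
Proof. exact: (tlift0 tail_icomul2_bilinear). Qed.

Lemma tail_icomul2M : {morph tail_icomul2 : x y / x * y}.
Proof.
move=> x y; elim/(@tprod_ind F H (tpow H 1)): x => [|a g|x z hx hz].
- by rewrite mul0r tail_icomul2_0 mul0r.
- elim/(@tprod_ind F H (tpow H 1)): y => [|b h|y z hy hz].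
  + by rewrite mulr0 tail_icomul2_0 mulr0.
  + rewrite [X in tail_icomul2 X]tpureM !tail_icomul2_pure icomul2M.
    by rewrite [RHS]tpureM.
  + by rewrite mulrDr !tail_icomul2D mulrDr hy hz.
- by rewrite mulrDl !tail_icomul2D mulrDl hx hz.
Qed.

(** Coassociativity again; it makes [spread_tail] well defined over [H]. *)
Lemma tail_icomul2_icomul (h : H) :
  tail_icomul2 (icomul 2 h) = icomul (m + k).+2 h.
Proof.
have B1 := @icomulS_bilinear F H 1.
have B2 := @icomulS_bilinear F H (m + k).+1.
have -> : icomul 2 h = tlift (fun a b : H => a \ox icomul 1 b) (comul h) by [].
have -> : icomul (m + k).+2 h =
  tlift (fun a b : H => a \ox icomul (m + k).+1 b) (comul h) by [].
elim/tprod_ind: (comul h) => [|a b|x y hx hy].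
- by rewrite (tlift0 B1) (tlift0 B2) tail_icomul2_0.
- rewrite (tlift_pure B1) (tlift_pure B2) tail_icomul2_pure.
  by rewrite icomul1 icomul2_comul.
- by rewrite (tliftD B1) (tliftD B2) tail_icomul2D hx hy.
Qed.

Lemma tail_icomul2_tcat1 (g : tpow H 1) :
  tail_icomul2 (@tcat F H 1 0 g 1) = @tcat F H m.+1 k (icomul2 0 m g) 1.
Proof.
elim/(@tprod_ind F H H): g => [|a b|x y hx hy].
- by rewrite icomul2_0 !tcat0l tail_icomul2_0.
- rewrite tcatS tail_icomul2_pure !icomul2_pure icomul_1.
  by rewrite [RHS](@tcatS F H m k a (icomul m b) 1).
- by rewrite icomul2D !tcatDl tail_icomul2D hx hy.
Qed.

Lemma tail_icomul2_1tcat (g : tpow H 1) :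
  tail_icomul2 (@tcat F H 0 1 1 g) = @tcat F H 0 (m + k).+1 1 (icomul2 m k g).
Proof. exact: tail_icomul2_pure. Qed.

Lemma tail_icomul2_icomul2l (g : tpow H 1) :
  tail_icomul2 (icomul2 1 0 g) = icomul2 m.+1 k g.
Proof.
elim/(@tprod_ind F H H): g => [|a b|x y hx hy].
- by rewrite !icomul2_0 tail_icomul2_0.
- rewrite !icomul2_pure icomul1.
  have B := @icomulS_bilinear F H m.
  have -> : icomul m.+1 a =
    tlift (fun a1 a2 : H => a1 \ox icomul m a2) (comul a) by [].
  elim/(@tprod_ind F H H): (comul a) => [|a1 a2|x y hx hy].
  + by rewrite (tlift0 B) !tcat0l tail_icomul2_0.
  + rewrite (tlift_pure B) !tcatS tail_icomul2_pure; congr (_ \ox _).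
    exact: icomul2_pure.
  + by rewrite (tliftD B) !tcatDl tail_icomul2D hx hy.
- by rewrite !icomul2D tail_icomul2D hx hy.
Qed.

Lemma tail_icomul2_icomul2r (g : tpow H 1) :
  tail_icomul2 (icomul2 0 1 g) = icomul2 0 (m + k).+1 g.
Proof.
elim/(@tprod_ind F H H): g => [|a b|x y hx hy].
- by rewrite !icomul2_0 tail_icomul2_0.
- rewrite !icomul2_pure icomul1 -icomul2_comul; exact: tail_icomul2_pure.
- by rewrite !icomul2D tail_icomul2D hx hy.
Qed.

(* Rewriting with tail_icomul2M diverges when the product is taken in         *)
(* tpow H (1 + 0).+1 or tpow H (0 + 1).+1, which are only convertible to      *)
(* tpow H 2; hence these two instances.                                       *)
Lemma tail_icomul2_mull (g h : tpow H 1) :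
  tail_icomul2 (@tcat F H 1 0 g 1 * icomul2 1 0 h : tpow H (1 + 0).+1) =
  @tcat F H m.+1 k (icomul2 0 m g) 1 * icomul2 m.+1 k h.
Proof.
rewrite -tail_icomul2_tcat1 -tail_icomul2_icomul2l.
exact: (@tail_icomul2M (tcat g 1) (icomul2 1 0 h)).
Qed.

Lemma tail_icomul2_mulr (g h : tpow H 1) :
  tail_icomul2 (@tcat F H 0 1 1 g * icomul2 0 1 h : tpow H (0 + 1).+1) =
  @tcat F H 0 (m + k).+1 1 (icomul2 m k g) * icomul2 0 (m + k).+1 h.
Proof.
rewrite -tail_icomul2_1tcat -tail_icomul2_icomul2r.
etransitivity; last by [].
exact: (@tail_icomul2M (@tcat F H 0 1 1 g) (icomul2 0 1 h)).
Qed.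

Variable V : lmodType H.

Lemma spread_tail_balanced : pbalanced (fun (x : tpow H 2) (v : V) =>
  tail_icomul2 x \oxH v).
Proof.
split=> [v x y|x v w|x h v].
- by rewrite tail_icomul2D ppureDl.
- exact: ppureDr.
- by rewrite tail_icomul2M tail_icomul2_icomul ppure_bal.
Qed.

Definition spread_tail : pten 2 V -> pten (m + k).+2 V :=
  plift (fun (x : tpow H 2) (v : V) => tail_icomul2 x \oxH v).

Lemma spread_tail_pure (x : tpow H 2) (v : V) :
  spread_tail (x \oxH v) = tail_icomul2 x \oxH v.
Proof. exact: (plift_pure spread_tail_balanced). Qed.

Lemma spread_tailD : {morph spread_tail : X Y / X + Y}.
Proof. exact: (pliftD spread_tail_balanced). Qed.

Lemma spread_tail0 : spread_tail 0 = 0.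
Proof. exact: (plift0 spread_tail_balanced). Qed.

End SpreadTail.

Section SpreadPseudoprod.
Variables (F : fieldType) (H : hopfType F) (V1 V2 V3 : lmodType H).
Variables (op : V1 -> V2 -> pten 1 V3) (opB : pbilinear op) (m k : nat).

(** Together with [spread_tail_pone_pseudoprod], this carries an identity between triple products of
    single vectors over to last two arguments [1 (x)_H b] and [1 (x)_H c] of any degrees. *)
Lemma spread_tail_pseudoprod_pone (X : pten 1 V1) (w : V2) :
  spread_tail m k (pseudoprod op X (pone w)) =
  pseudoprod op (spread 0 m X) (1 \oxH w : pten k V2).
Proof.
elim/pten_ind: X => [|g v|X Y hX hY].
- by rewrite spread0 !(pseudoprod0l opB) spread_tail0.
- rewrite spread_pure !(pseudoprod_pure opB).
  elim/pten_ind: (op v w) => [|h u|Z Z' hZ hZ'].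
  + by rewrite !pseudoprod_expand0 spread_tail0.
  + rewrite pseudoprod_expand_pure spread_tail_pure tail_icomul2_mull.
    by rewrite (@pseudoprod_expand_pure F H V3 m.+1 k).
  + rewrite !pseudoprod_expandD -hZ -hZ'; exact: spread_tailD.
- rewrite spreadD !(pseudoprodDl opB) -hX -hY; exact: spread_tailD.
Qed.

Lemma spread_tail_pone_pseudoprod (v : V1) (Y : pten 1 V2) :
  spread_tail m k (pseudoprod op (pone v) Y) =
  pseudoprod op (pone v) (spread m k Y).
Proof.
elim/pten_ind: Y => [|g w|X Y hX hY].
- by rewrite spread0 !(pseudoprod0r opB) spread_tail0.
- rewrite spread_pure !(pseudoprod_pure opB).
  elim/pten_ind: (op v w) => [|h u|Z Z' hZ hZ'].
  + by rewrite !pseudoprod_expand0 spread_tail0.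
  + rewrite pseudoprod_expand_pure spread_tail_pure tail_icomul2_mulr.
    by rewrite (@pseudoprod_expand_pure F H V3 0 (m + k).+1).
  + rewrite !pseudoprod_expandD -hZ -hZ'; exact: spread_tailD.
- rewrite spreadD !(pseudoprodDr opB) -hX -hY; exact: spread_tailD.
Qed.

End SpreadPseudoprod.

(** * Associativity of the composition rule *)

Section Associativity.
Variables (F : fieldType) (H : hopfType F) (V1 V2 V3 W W' U : lmodType H).
Variables (op12 : V1 -> V2 -> pten 1 W) (opl : W -> V3 -> pten 1 U).
Variables (op23 : V2 -> V3 -> pten 1 W') (opr : V1 -> W' -> pten 1 U).
Hypotheses (B12 : pbilinear op12) (Bl : pbilinear opl).
Hypotheses (B23 : pbilinear op23) (Br : pbilinear opr).
Hypothesis opA : forall a b c,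
  pseudoprod opl (op12 a b) (pone c) = pseudoprod opr (pone a) (op23 b c).

(** Linearity reduces to [Y = 1 (x)_H b] and [Z = 1 (x)_H c], where the claim is the image of [opA]
    under [spread_tail]. With a first argument of degree [0] the two bracketings have convertible
    types. *)
Lemma pseudoprodA_pone m k a (Y : pten m V2) (Z : pten k V3) :
  pseudoprod opl (pseudoprod op12 (pone a) Y : pten m.+1 W) Z =
  pseudoprod opr (pone a) (pseudoprod op23 Y Z).
Proof.
elim/pten_ind: Y => [|y b|Y Y' hY hY'].
- by rewrite pseudoprod0r // !pseudoprod0l // pseudoprod0r.
- elim/pten_ind: Z => [|z c|Z Z' hZ hZ'].
  + by rewrite !pseudoprod0r.
  (* All coefficients are pulled out, leaving units in the three arguments. *)
  + rewrite -[y]mulr1 -[z]mulr1 !ppureZ -[pone a]scale1r !pseudoprodZ //.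
    congr (_ *: _); first exact: (@tcatS F H m k 1 y z).
    rewrite !pseudoprod_spread // -spread_tail_pseudoprod_pone // opA.
    exact: spread_tail_pone_pseudoprod.
  + by rewrite !pseudoprodDr // hZ hZ'.
- rewrite [X in pseudoprod opl X]pseudoprodDr // !pseudoprodDl // hY hY'.
  by rewrite pseudoprodDr.
Qed.

(** Both sides commute with [ins] in the first argument; what is left after splitting off one factor
    of [X] is a single vector. *)
Lemma pseudoprodA_tpow1 m k (X : pten 1 V1) (Y : pten m V2) (Z : pten k V3) :
  pseudoprod opl (pseudoprod op12 X Y : pten m.+2 W) Z =
  pseudoprod opr X (pseudoprod op23 Y Z).
Proof.
elim/ins_ind: X => [|f X|X X' hX hX'].
- by rewrite !pseudoprod0l.
- have [a ->] := pone_surj X.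
  rewrite !pseudoprod_ins //; congr (ins _ _); exact: pseudoprodA_pone.
- by rewrite !pseudoprodDl // hX hX'.
Qed.

End Associativity.

(** * Finite coordinate systems for the first factor *)

Section Coordinates.
Variables (F : fieldType) (H : hopfType F) (V : lmodType H) (n : nat).

Lemma ins_spanning_seq (s : seq (pten n.+1 V)) :
  exists t : seq H, forall X, X \in s -> exists2 r : seq (H * pten n V),
    {subset [seq p.1 | p <- r] <= t} & X = \sum_(p <- r) ins p.1 p.2.
Proof.
elim: s => [|X s [t st]]; first by exists [::].
have [r Xr] := ins_spanning X.
exists ([seq p.1 | p <- r] ++ t) => Y; rewrite inE => /predU1P[->|/st[q qt Yq]].
  by exists r => // f fr; rewrite mem_cat fr.
by exists q => // f /qt ft; rewrite mem_cat ft orbT.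
Qed.

(** Finitely many elements involve finitely many first factors, and [finite_coordinates] for these
    factors recovers each element from its coordinates. *)
Lemma ins_peel_sum (s : seq (pten n.+1 V)) :
  exists d : seq (H * {scalar H}),
    forall X, X \in s -> X = \sum_(q <- d) ins q.1 (peel q.2 X).
Proof.
have [t st] := ins_spanning_seq s; have [d td] := finite_coordinates t.
exists d => X /st[r rt ->].
have peel_sum l : peel l (\sum_(p <- r) ins p.1 p.2) =
    \sum_(p <- r) (l p.1)%:A *: p.2.
  rewrite (big_morph _ (@peelD F H V n l) (@peel0 F H V n l)).
  by apply: eq_bigr => p _; exact: peel_ins.
under [RHS]eq_bigr => q _ do
  rewrite peel_sum (big_morph _ (@insD F H V n q.1) (@ins0 F H V n q.1)).
(* Regrouped by [p], the inner sum is the expansion of [p.1] pushed through [ins], which is linear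
   in that argument. *)
rewrite exchange_big /= [LHS]big_seq [RHS]big_seq; apply: eq_bigr => p pr.
rewrite {1}(td p.1 (rt _ (map_f _ pr))).
rewrite (big_morph _ (insDl p.2) (ins0l p.2)).
by apply: eq_bigr => q _; exact: insZl.
Qed.

Lemma peel_eq0 (X : pten n.+1 V) : (forall l, peel l X = 0) -> X = 0.
Proof.
move=> X0; have [d dX] := ins_peel_sum [:: X].
rewrite (dX X (mem_head _ _)) big1 // => q _.
by rewrite X0 ins0.
Qed.

End Coordinates.

(** By [insZ1], left multiplication from the third factor on does not interfere with splitting off
    the first. *)
Lemma peelZ1 (F : fieldType) (H : hopfType F) (V : lmodType H) n l
    (K : tpow H n) (X : pten n.+2 V) :
  peel l ((1 \ox (1 \ox K) : tpow H n.+2) *: X) =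
  (1 \ox K : tpow H n.+1) *: peel l X.
Proof.
elim/ins_ind: X => [|f X|X Y hX hY].
- by rewrite scaler0 !peel0 scaler0.
- rewrite -insZ1 !peel_ins !scalerA; congr (_ *: _).
  by rewrite mulr_algl mulr_algr.
- by rewrite scalerDr !peelD hX hY scalerDr.
Qed.

(** * Tensors over Chom as maps on [M] *)

Section ChomTensor.
Variables (F : fieldType) (H : hopfType F) (M N : lmodType H).
Local Notation C := (Chom M N).
Local Notation "X @@ Y" := (pseudoprod (@chom_eval F H M N) X Y)
  (at level 40).
Let evB := @chom_eval_pbilinear F H M N.

(** Induction on the degree: in degree [0] the element is a single map [phi] with [X * u = phi u];
    in higher degree each [peel l X] also vanishes at every [u], and the coordinates detect [X]. *)
Lemma chom_tensor_eq0 n (X : pten n C) :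
  (forall u, X @@ pone u = 0) -> X = 0.
Proof.
elim: n X => [|n IH] X X0.
  have [phi Xphi] := pone_surj X.
  rewrite Xphi in X0 *; suff -> : phi = 0 by exact: pone0.
  by apply: chom_ext => u; have := X0 u; rewrite pseudoprod_pone.
apply: peel_eq0 => l; apply: IH => u.
by rewrite -peel_pseudoprod // X0 peel0.
Qed.

Lemma chom_tensor_ext n (X Y : pten n C) :
  (forall u, X @@ pone u = Y @@ pone u) -> X = Y.
Proof.
move=> XY; apply/eqP; rewrite -subr_eq0; apply/eqP/chom_tensor_eq0 => u.
apply: (addIr (Y @@ pone u)).
by rewrite -pseudoprodDl // subrK add0r XY.
Qed.

Lemma chom_tensor_eval_pseudolinear (X : pten 1 C) (h : H) u :
  X @@ pone (h *: u) = (1 \ox (1 \ox h) : tpow H 2) *: (X @@ pone u).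
Proof.
rewrite poneZ -{1}[X]scale1r pseudoprodZ //; congr (_ *: _).
exact: (@tcatS F H 0 0 1 1 h).
Qed.

(** The coordinates of [T] along the first factor are the elements of Chom from which the required
    tensor is assembled. *)
Lemma peel_pseudolinear l (T : M -> pten 2 N) :
  {morph T : u v / u + v} ->
  (forall (h : H) u, T (h *: u) = (1 \ox (1 \ox h) : tpow H 2) *: T u) ->
  (fun u => peel l (T u)) \in @pseudolinearb F H M N.
Proof.
move=> TD TZ; apply/asboolP; split=> [u v|h u]; first by rewrite TD peelD.
by rewrite TZ; exact: peelZ1.
Qed.

(** Finiteness of [M] enters here: one finite coordinate system has to serve all values of [T], and
    it does as soon as it serves the values at generators. *)
Lemma chom_tensor_exists (finM : finite_module M) (T : M -> pten 2 N)
    (TD : {morph T : u v / u + v})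
    (TZ : forall (h : H) u,
      T (h *: u) = (1 \ox (1 \ox h) : tpow H 2) *: T u) :
  exists X : pten 1 C, forall u, X @@ pone u = T u.
Proof.
have [k [e span_e]] := finM.
have [d dT] := ins_peel_sum [seq T (e i) | i <- enum 'I_k].
pose phi l : C := MkChom (peel_pseudolinear l TD TZ).
(* Evaluated at [u], this is the sum of [ins q.1 (peel q.2 (T u))], the reconstruction of [T u] from
   its coordinates. *)
exists (\sum_(q <- d) ins q.1 (pone (phi q.2))).
set X := \sum_(q <- d) _.
pose ev u : pten 2 N := X @@ pone u.
have evD : {morph ev : u v / u + v}.
  by move=> u v; rewrite /ev poneD pseudoprodDr.
have ev0 : ev 0 = 0 by apply: (addrI (ev 0)); rewrite -evD !addr0.
have T0 : T 0 = 0 by apply: (addrI (T 0)); rewrite -TD !addr0.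
(* Evaluation and [T] are additive and transform alike under [h], so they need only be compared at
   the generators [e i]. *)
move=> u; rewrite -/(ev u); have [c ->] := span_e u.
rewrite (big_morph _ evD ev0) (big_morph _ TD T0); apply: eq_bigr => i _.
rewrite TZ /ev chom_tensor_eval_pseudolinear; congr (_ *: _).
rewrite (dT (T (e i))); last by rewrite map_f ?mem_enum.
have evlD : {morph (fun Y : pten 1 C => Y @@ pone (e i) : pten 2 N) :
    Y Z / Y + Z}.
  by move=> Y Z; rewrite (pseudoprodDl evB).
have evl0 : (0 : pten 1 C) @@ pone (e i) = 0 :> pten 2 N.
  by rewrite (pseudoprod0l evB).
rewrite (big_morph _ evlD evl0); apply: eq_bigr => q _.
by rewrite pseudoprod_ins // pseudoprod_pone.
Qed.

End ChomTensor.

(** * The two actions on Chom and their axioms *)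

Section ChomActions.
Variables (F : fieldType) (H : hopfType F) (A : lmodType H).
Variables (mulA : A -> A -> pten 1 A) (M N : lmodType H).
Variables (aM : A -> M -> pten 1 M) (aN : A -> N -> pten 1 N).
Hypotheses (mulB : pbilinear mulA).
Hypotheses (hM : left_module mulA aM) (hN : left_module mulA aN).
Let aMB := lmodule_bilin hM.
Let aNB := lmodule_bilin hN.
Local Notation C := (Chom M N).
Local Notation ev := (@chom_eval F H M N).
Let evB := @chom_eval_pbilinear F H M N.

(** Multiplying by [a] on the left shifts the [1 (x) h] of pseudolinearity of [phi] to
    [1 (x) 1 (x) h], as [chom_tensor_exists] demands. *)
Lemma chom_lact_exists (finM : finite_module M) (a : A) (phi : C) :
  exists X : pten 1 C, forall u : M,
    pseudoprod ev X (pone u) = pseudoprod aN (pone a) (phi u).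
Proof.
have [phiD phiZ] := chomP phi.
apply: chom_tensor_exists => // [u v|h u]; first by rewrite phiD pseudoprodDr.
by rewrite phiZ -[pone a]scale1r pseudoprodZ // scale1r.
Qed.

Lemma chom_ract_exists (finM : finite_module M) (phi : C) (a : A) :
  exists X : pten 1 C, forall u : M,
    pseudoprod ev X (pone u) = pseudoprod ev (pone phi) (aM a u).
Proof.
apply: chom_tensor_exists => // [u v|h u].
  by rewrite (pbilinDr aMB) pseudoprodDr.
rewrite -[a in LHS]scale1r (pbilinZ aMB) -[pone phi]scale1r pseudoprodZ //.
by rewrite scale1r.
Qed.

Lemma chom_evalZ (h g : H) (X : pten 1 C) (u : M) :
  pseudoprod ev ((h \ox g : tpow H 1) *: X) (pone u) =
  (h \ox (g \ox 1) : tpow H 2) *: pseudoprod ev X (pone u).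
Proof.
rewrite -[pone u in LHS]scale1r pseudoprodZ //; congr (_ *: _).
exact: (@tcatS F H 0 0 h g 1).
Qed.

Variables (lact : A -> C -> pten 1 C) (ract : C -> A -> pten 1 C).
Hypothesis lactE : forall a phi u,
  pseudoprod ev (lact a phi) (pone u) = pseudoprod aN (pone a) (phi u).
Hypothesis ractE : forall phi a u,
  pseudoprod ev (ract phi a) (pone u) = pseudoprod ev (pone phi) (aM a u).

Lemma chom_lact_bilin : pbilinear lact.
Proof.
split=> [phi a b|a phi psi|h g a phi]; apply: chom_tensor_ext => u.
- by rewrite lactE poneD (pseudoprodDl evB) !lactE pseudoprodDl.
- by rewrite lactE (pseudoprodDl evB) !lactE chomDE pseudoprodDr.
- by rewrite lactE poneZ chom_evalZ lactE pseudoprodZ.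
Qed.

Lemma chom_ract_bilin : pbilinear ract.
Proof.
split=> [a phi psi|phi a b|h g phi a]; apply: chom_tensor_ext => u.
- by rewrite ractE poneD (pseudoprodDl evB) (pseudoprodDl evB) !ractE.
- by rewrite ractE (pbilinDl aMB) (pseudoprodDl evB) (pseudoprodDr evB) !ractE.
- rewrite ractE poneZ -[u in aM _ u]scale1r (pbilinZ aMB) chom_evalZ ractE.
  by rewrite pseudoprodZ.
Qed.

Let lB := chom_lact_bilin.
Let rB := chom_ract_bilin.

Let lactA a phi u : pseudoprod ev (lact a phi) (pone u) =
  pseudoprod aN (pone a) (ev phi u).
Proof. exact: lactE. Qed.

(** Evaluated at [u], the two sides become [(a * b) * (phi * u)] and [a * (b * (phi * u))], which
    agree by the module axiom of [N]. *)
Lemma chom_left_module : left_module mulA lact.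
Proof.
split=> // a b phi; apply: chom_tensor_ext => u.
(* The defining equation of the left action is itself the associativity hypothesis for [lact], [ev],
   [ev], [aN]. *)
have L := pseudoprodA_tpow1 lB evB evB aNB lactA (mulA a b) (pone phi) (pone u).
have R := pseudoprodA_pone lB evB evB aNB lactA a (lact b phi) (pone u).
rewrite [LHS]L [RHS]R lactE pseudoprod_pone //.
have /= <- := pseudoprodA_pone mulB aNB aNB aNB (lmodule_assoc hN) a (pone b)
  (phi u).
by rewrite pseudoprod_pone.
Qed.

(** Evaluated at [u], both sides reduce to [phi * (a * (b * u))], through the module axiom of
    [M]. *)
Lemma chom_right_module : right_module mulA ract.
Proof.
split=> // phi a b; apply: chom_tensor_ext => u.
have L := pseudoprodA_tpow1 rB evB aMB evB ractE (ract phi a) (pone b) (pone u).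
have R := pseudoprodA_pone rB evB aMB evB ractE phi (mulA a b) (pone u).
rewrite [LHS]L [RHS]R (lmodule_assoc hM) pseudoprod_pone //.
have := pseudoprodA_pone rB evB aMB evB ractE phi (pone a) (aM b u).
by rewrite pseudoprod_pone.
Qed.

(** For compatibility, both sides evaluated at [u] are [a * (phi * (b * u))]; only the defining
    equations of the actions are needed. *)
Lemma chom_bimodule : bimodule mulA lact ract.
Proof.
split; [exact: chom_left_module|exact: chom_right_module|move=> a phi b].
apply: chom_tensor_ext => u.
have L := pseudoprodA_tpow1 rB evB aMB evB ractE (lact a phi) (pone b) (pone u).
have R := pseudoprodA_pone lB evB evB aNB lactA a (ract phi b) (pone u).
rewrite [LHS]L [RHS]R ractE pseudoprod_pone //.
have := pseudoprodA_pone lB evB evB aNB lactA a (pone phi) (aM b u).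
by rewrite pseudoprod_pone.
Qed.

End ChomActions.

Theorem proposition4p2 (F : fieldType) (H : hopfType F)
    (charF0 : [pchar F] =i pred0)
    (A : lmodType H) (mulA : A -> A -> pten 1 A)
    (hA : assoc_pseudoalgebra mulA)
    (M N : lmodType H)
    (aM : A -> M -> pten 1 M) (aN : A -> N -> pten 1 N)
    (hM : left_module mulA aM) (hN : left_module mulA aN)
    (finM : finite_module M) (finN : finite_module N) :
  exists (lact : A -> Chom M N -> pten 1 (Chom M N))
         (ract : Chom M N -> A -> pten 1 (Chom M N)),
    [/\ (forall (a : A) (phi : Chom M N), unique
           (fun X : pten 1 (Chom M N) => forall u : M,
              pseudoprod (@chom_eval F H M N) X (pone u) =
              pseudoprod aN (pone a) (phi u))
           (lact a phi)),
        left_module mulA lact,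
        (forall (phi : Chom M N) (a : A), unique
           (fun X : pten 1 (Chom M N) => forall u : M,
              pseudoprod (@chom_eval F H M N) X (pone u) =
              pseudoprod (@chom_eval F H M N) (pone phi) (aM a u))
           (ract phi a)),
        right_module mulA ract &
        bimodule mulA lact ract].
Proof.
have mulB := pseudoalg_bilin hA.
have [lact lactE] : exists lact : A -> Chom M N -> pten 1 (Chom M N),
    forall a phi u, pseudoprod (@chom_eval F H M N) (lact a phi) (pone u) =
      pseudoprod aN (pone a) (phi u).
  (* Choosing over pairs turns existence for each [a] and [phi] into a single function. *)
  have [f fE] := choice (fun p => chom_lact_exists hN finM p.1 p.2).
  by exists (fun a phi => f (a, phi)) => a phi; exact: (fE (a, phi)).
have [ract ractE] : exists ract : Chom M N -> A -> pten 1 (Chom M N),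
    forall phi a u, pseudoprod (@chom_eval F H M N) (ract phi a) (pone u) =
      pseudoprod (@chom_eval F H M N) (pone phi) (aM a u).
  have [f fE] := choice (fun p : Chom M N * A =>
    chom_ract_exists hM finM p.1 p.2).
  by exists (fun phi a => f (phi, a)) => phi a; exact: (fE (phi, a)).
exists lact, ract; split.
(* Uniqueness holds because an element over Chom is determined by its values, by
   [chom_tensor_ext]. *)
- move=> a phi; split=> [|X XE]; first exact: lactE.
  by apply: chom_tensor_ext => u; rewrite lactE XE.
- exact: (chom_left_module mulB hN lactE).
- move=> phi a; split=> [|X XE]; first exact: ractE.
  by apply: chom_tensor_ext => u; rewrite ractE XE.
- exact: (chom_right_module hM ractE).
- exact: (chom_bimodule mulB hM hN lactE ractE).
Qed.
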